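(* For $\beta>0$ and $\lambda>\frac23$ put $\sigma=\lambda(\beta+2)-1$ (so $\lambda=\frac{\sigma+1}{\beta+2}$). (a) For $\lambda>\frac23$ let $(k_1,B_1)$ be the unique solution of system (S1) in the context with $0<k_1<1$, $B_1>0$, and set $$R_1(\lambda)=\frac{B_1}{\sigma}\left(1-\frac{2E(k_1)}{K(k_1)}\right).$$ For fixed $\beta,\sigma$ the transport $H_1$ of the stable symmetric periodic orbit satisfies, as $\rho\to\infty$, $$\frac{H_1}{\rho}=\beta\left(1-R_1(\lambda)+O(\rho^{-1/2})\right).$$ (b) For $\frac23<\lambda<1$ let $(k_2,B_2)$ be the unique solution of system (S2) in the context with $0<k_2<1$, $B_2>0$, and set $$R_2(\lambda)=\frac{B_2}{\sigma}\,\frac{K(k_2)(2-k_2^2)-2E(k_2)}{K(k_2)\,k_2^2}.$$ For fixed $\beta,\sigma$ the transport $H_2$ of each of the two unstable asymmetric periodic orbits satisfies, as $\rho\to\infty$, $$\frac{H_2}{\rho}=\beta\left(1-R_2(\lambda)+O(\rho^{-1/2})\right).$$ (c) For fixed $\beta>0$, $$\lim_{\lambda\searrow2/3}R_1(\lambda)=\lim_{\lambda\searrow2/3}R_2(\lambda)=1,\qquad \lim_{\lambda\to\infty}R_1(\lambda)=0,\qquad \lim_{\lambda\nearrow1}R_2(\lambda)=0.$$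
   Context: The Lorenz equations are $X'=\sigma(Y-X)$, $Y'=\rho X-Y-XZ$, $Z'=-\beta Z+XY$ with $\sigma,\beta>0$. The transport of a solution is $H=\limsup_{t\to\infty}\frac1t\int_0^tX(s)Y(s)\,ds$. For $0<k<1$ (elliptic modulus $k$), $K=K(k)=\int_0^1\frac{dt}{\sqrt{(1-t^2)(1-k^2t^2)}}$ and $E=E(k)=\int_0^1\sqrt{\frac{1-k^2t^2}{1-t^2}}\,dt$ are the complete elliptic integrals; $\mathrm{sn},\mathrm{cn},\mathrm{dn}$ are the Jacobi elliptic functions. System (S1), with $k=k_1$, $B=B_1$: $$K\beta\sigma+\beta B(2E-K)-4B\sigma\big(E-(1-k^2)K\big)=0,$$ $$4B\big[(1-k^2)K+(2k^2-1)E\big]+3\beta\sigma(2E-K)+\beta B\big[(4k^2-1)K+4(1-2k^2)E\big]=0;$$ it has a unique solution with $0<k<1,B>0$ for each $\lambda>2/3$. System (S2), with $k=k_2$, $B=B_2$: $$\beta\sigma K-4B\sigma k^{-2}E-\beta Bk^{-2}\big((2-k^2)K-2E\big)=0,$$ $$4B\big[(2-k^2)E-2(1-k^2)K\big]+\beta B\big[4(k^2-2)E+(3k^4-8k^2+8)K\big]+3\beta\sigma k^2\big[2E-K(2-k^2)\big]=0;$$ it has a unique solution with $0<k<1,B>0$ for each $2/3<\lambda<1$. With $\varepsilon=\rho^{-1/2}$, $X=\varepsilon^{-1}\xi$, $Y=\varepsilon^{-2}\sigma^{-1}\eta$, $Z=\varepsilon^{-2}(\sigma^{-1}\zeta+1)$,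 $t=\varepsilon\tau$, the Lorenz equations become (R): $\dot\xi=\eta-\varepsilon\sigma\xi$, $\dot\eta=-\xi\zeta-\varepsilon\eta$, $\dot\zeta=\xi\eta-\varepsilon\beta(\zeta+\sigma)$. The stable symmetric periodic orbit (for $\lambda>2/3$ and $\rho$ large) is the asymptotically stable periodic orbit of (R), invariant under $(\xi,\eta,\zeta)\mapsto(-\xi,-\eta,\zeta)$, that is the unique periodic orbit in an order-$\varepsilon$ neighborhood of the $\varepsilon=0$ orbit $\xi=2k_1\sqrt{B_1}\,\mathrm{cn}(u,k_1)$, $\eta=-2k_1B_1\,\mathrm{dn}(u,k_1)\mathrm{sn}(u,k_1)$, $\zeta=B_1(1-2k_1^2\mathrm{sn}^2(u,k_1))$, $u=\sqrt{B_1}\tau$. The two unstable asymmetric periodic orbits (for $2/3<\lambda<1$ and $\rho$ large) are the saddle-type periodic orbits of (R) that are the unique periodic orbits in order-$\varepsilon$ neighborhoods of the $\varepsilon=0$ orbits $\xi=\pm2\sqrt{B_2}\,k_2^{-1}\mathrm{dn}(u,k_2)$, $\eta=\mp2B_2\,\mathrm{sn}(u,k_2)\mathrm{cn}(u,k_2)$, $\zeta=B_2(1-2\,\mathrm{sn}^2(u,k_2))$, $u=\sqrt{B_2}k_2^{-1}\tau$. *)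

(* Defs.v *)
(* Stdlib reals and Coquelicot. *)
From Stdlib Require Import Reals.
From Coquelicot Require Import Coquelicot.
Open Scope R_scope.

(* All elliptic quantities take the modulus k as argument, not m = k^2.  The
   integrands are unbounded at 1, hence the improper integrals. *)
Definition ellK (k : R) : R :=
  RInt_gen (fun t => / sqrt ((1 - t ^ 2) * (1 - k ^ 2 * t ^ 2)))
           (at_point 0) (at_left 1).

Definition ellE (k : R) : R :=
  RInt_gen (fun t => sqrt ((1 - k ^ 2 * t ^ 2) / (1 - t ^ 2)))
           (at_point 0) (at_left 1).

(* The Jacobi functions are obtained by inverting the incomplete integral of
   the first kind, which for 0 < k < 1 is a bijection of R in phi. *)
Definition ellF (phi k : R) : R :=
  RInt (fun theta => / sqrt (1 - k ^ 2 * sin theta ^ 2)) 0 phi.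

Definition am (u k : R) : R := iota (fun phi : R => ellF phi k = u).
Definition sn (u k : R) : R := sin (am u k).
Definition cn (u k : R) : R := cos (am u k).
Definition dn (u k : R) : R := sqrt (1 - k ^ 2 * sn u k ^ 2).

Definition S1 (beta sigma : R) (kB : R * R) : Prop :=
  let (k, B) := kB in
  let K := ellK k in
  let E := ellE k in
  0 < k < 1 /\ 0 < B /\
  K * beta * sigma + beta * B * (2 * E - K)
    - 4 * B * sigma * (E - (1 - k ^ 2) * K) = 0 /\
  4 * B * ((1 - k ^ 2) * K + (2 * k ^ 2 - 1) * E)
    + 3 * beta * sigma * (2 * E - K)
    + beta * B * ((4 * k ^ 2 - 1) * K + 4 * (1 - 2 * k ^ 2) * E) = 0.

Definition S2 (beta sigma : R) (kB : R * R) : Prop :=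
  let (k, B) := kB in
  let K := ellK k in
  let E := ellE k in
  0 < k < 1 /\ 0 < B /\
  beta * sigma * K - 4 * B * sigma * / k ^ 2 * E
    - beta * B * / k ^ 2 * ((2 - k ^ 2) * K - 2 * E) = 0 /\
  4 * B * ((2 - k ^ 2) * E - 2 * (1 - k ^ 2) * K)
    + beta * B * (4 * (k ^ 2 - 2) * E + (3 * k ^ 4 - 8 * k ^ 2 + 8) * K)
    + 3 * beta * sigma * k ^ 2 * (2 * E - K * (2 - k ^ 2)) = 0.

Definition sigma_of (beta lambda : R) : R := lambda * (beta + 2) - 1.

Definition ratio1 (sigma k B : R) : R :=
  B / sigma * (1 - 2 * ellE k / ellK k).

Definition ratio2 (sigma k B : R) : R :=
  B / sigma * ((ellK k * (2 - k ^ 2) - 2 * ellE k) / (ellK k * k ^ 2)).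

Definition vec3 : Type := (R * R * R)%type.

Definition is_solution (f : vec3 -> vec3) (g : R -> vec3) : Prop :=
  forall t : R, is_derive g t (f (g t)).

Definition is_forward_solution (f : vec3 -> vec3) (g : R -> vec3) : Prop :=
  forall t : R, 0 <= t -> is_derive g t (f (g t)).

Definition lorenz (sigma rho beta : R) (p : vec3) : vec3 :=
  let '(X, Y, Z) := p in
  (sigma * (Y - X), rho * X - Y - X * Z, - beta * Z + X * Y).

Definition rescaled_lorenz (sigma beta eps : R) (p : vec3) : vec3 :=
  let '(xi, eta, zeta) := p in
  (eta - eps * sigma * xi,
   - xi * zeta - eps * eta,
   xi * eta - eps * beta * (zeta + sigma)).

Definition eps_of (rho : R) : R := / sqrt rho.

(* Solves X = xi / eps, Y = eta / (eps^2 sigma), Z = (zeta / sigma + 1) / eps^2,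
   t = eps tau for (xi, eta, zeta) as functions of tau. *)
Definition rescale (sigma rho : R) (L : R -> vec3) (tau : R) : vec3 :=
  let eps := eps_of rho in
  let '(X, Y, Z) := L (eps * tau) in
  (eps * X, eps ^ 2 * sigma * Y, sigma * (eps ^ 2 * Z - 1)).

(* limsup as t -> +oo, i.e. inf over T of sup over t >= T. *)
Definition LimSup_p_infty (f : R -> R) : Rbar :=
  Rbar_glb (fun s : Rbar =>
    exists T : R, s = Lub_Rbar (fun y : R => exists t : R, T <= t /\ y = f t)).

Definition transport (L : R -> vec3) : Rbar :=
  LimSup_p_infty (fun t =>
    / t * RInt (fun s => fst (fst (L s)) * snd (fst (L s))) 0 t).

Definition orbit (g : R -> vec3) (p : vec3) : Prop := exists t : R, g t = p.

(* The norm on R * R * R is the Euclidean one. *)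
Definition near_orbit (g : R -> vec3) (d : R) (p : vec3) : Prop :=
  exists s : R, norm (minus p (g s)) < d.

Definition is_period (g : R -> vec3) (T : R) : Prop :=
  0 < T /\ forall t : R, g (t + T) = g t.

Definition periodic_orbit (f : vec3 -> vec3) (g : R -> vec3) : Prop :=
  is_solution f g /\ (exists T : R, is_period g T) /\
  (exists t : R, g t <> g 0).

Definition unique_periodic_orbit_near
    (f : vec3 -> vec3) (g0 : R -> vec3) (d : R) (g : R -> vec3) : Prop :=
  periodic_orbit f g /\
  (forall t : R, near_orbit g0 d (g t)) /\
  (forall h : R -> vec3,
     periodic_orbit f h -> (forall t : R, near_orbit g0 d (h t)) ->
     forall p : vec3, orbit h p <-> orbit g p).

Definition reflect_xy (p : vec3) : vec3 :=
  let '(x, y, z) := p in (- x, - y, z).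

Definition symmetric_orbit (g : R -> vec3) : Prop :=
  forall p : vec3, orbit g p <-> orbit g (reflect_xy p).

(* Asymptotic stability of the orbit as a set.  Only solutions on all of
   [0, +oo) are tested; for positive parameters every solution of the Lorenz
   equations is of this kind. *)
Definition asymptotically_stable_orbit (f : vec3 -> vec3) (g : R -> vec3) : Prop :=
  (forall d : R, 0 < d ->
     exists d0 : R, 0 < d0 /\
       forall h : R -> vec3, is_forward_solution f h -> near_orbit g d0 (h 0) ->
       forall t : R, 0 <= t -> near_orbit g d (h t)) /\
  (exists d0 : R, 0 < d0 /\
     forall h : R -> vec3, is_forward_solution f h -> near_orbit g d0 (h 0) ->
     forall d : R, 0 < d ->
       exists T : R, 0 <= T /\ forall t : R, T <= t -> near_orbit g d (h t)).

(* Solutions of v' = Df(g) v, with Df(g) v as a directional derivative. *)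
Definition variational_solution
    (f : vec3 -> vec3) (g v : R -> vec3) : Prop :=
  forall t : R, exists w : vec3,
    is_derive (fun s : R => (f (plus (g t) (scal s (v t))) : vec3)) 0 w /\
    is_derive v t w.

Definition floquet_multiplier
    (f : vec3 -> vec3) (g : R -> vec3) (T mu : R) : Prop :=
  exists v : R -> vec3,
    variational_solution f g v /\ v 0 <> (0, 0, 0) /\
    forall t : R, v (t + T) = scal mu (v t).

(* In dimension 3 these two multipliers and the trivial multiplier 1 are all
   of them; two of distinct moduli are necessarily real. *)
Definition saddle_orbit (f : vec3 -> vec3) (g : R -> vec3) : Prop :=
  exists T mu_s mu_u : R,
    is_period g T /\
    floquet_multiplier f g T mu_s /\ Rabs mu_s < 1 /\
    floquet_multiplier f g T mu_u /\ 1 < Rabs mu_u.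

Definition cn_orbit (k B tau : R) : vec3 :=
  let u := sqrt B * tau in
  (2 * k * sqrt B * cn u k,
   - 2 * k * B * dn u k * sn u k,
   B * (1 - 2 * k ^ 2 * sn u k ^ 2)).

(* s = 1 and s = -1 select the two orbits. *)
Definition dn_orbit (s k B tau : R) : vec3 :=
  let u := sqrt B * / k * tau in
  (s * (2 * sqrt B * / k * dn u k),
   - s * (2 * B * sn u k * cn u k),
   B * (1 - 2 * sn u k ^ 2)).

(* g rho is the orbit for the parameter rho; the constant C of the order-eps
   neighborhood does not depend on rho. *)
Definition is_stable_symmetric_orbit
    (beta sigma k B : R) (g : R -> R -> vec3) : Prop :=
  exists C rho0 : R, 0 < C /\ 0 < rho0 /\
    forall rho : R, rho0 < rho ->
      let f := rescaled_lorenz sigma beta (eps_of rho) in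
      unique_periodic_orbit_near f (cn_orbit k B) (C * eps_of rho) (g rho) /\
      symmetric_orbit (g rho) /\
      asymptotically_stable_orbit f (g rho).

Definition is_unstable_asymmetric_orbit
    (beta sigma s k B : R) (g : R -> R -> vec3) : Prop :=
  exists C rho0 : R, 0 < C /\ 0 < rho0 /\
    forall rho : R, rho0 < rho ->
      let f := rescaled_lorenz sigma beta (eps_of rho) in
      unique_periodic_orbit_near f (dn_orbit s k B) (C * eps_of rho) (g rho) /\
      saddle_orbit f (g rho).

(* H rho / rho = beta * (1 - r + O(rho^(-1/2))) as rho -> +oo; in particular
   H rho is finite for large rho. *)
Definition transport_expansion (beta r : R) (H : R -> Rbar) : Prop :=
  exists M rho0 : R, 0 < rho0 /\
    forall rho : R, rho0 < rho ->
      exists e : R, Rabs e <= M * Rpower rho (- (1 / 2)) /\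
        Rbar_div (H rho) rho = Finite (beta * (1 - r + e)).

(* Main.v *)
Require Import Defs.
From Stdlib Require Import Reals Lra.
From Coquelicot Require Import Coquelicot.
Open Scope R_scope.

(** Since XY = Z' + beta Z and the orbit is bounded, the transport is beta times the time
    average of Z.  The eps = 0 orbit has a period that does not depend on eps, so by
    Gronwall the solution stays O(eps)-close to a time translate of that orbit over each
    such period, and the average of zeta is O(eps)-close to its average over the eps = 0
    orbit, namely -sigma R.

    For the limits, write e = E/K, m = 1 - k^2, and let <.> be the mean with density
    1/(K Delta) over [0, pi/2], Delta = sqrt (1 - k^2 sin^2).  With w minus the mean of
    zeta/B over the orbit, eliminating B shows that both systems reduce to
    lambda - 2/3 = S / (3 w A) and B/sigma <= (beta + 1) w, with
      (S1)  w = 1 - 2 e,            A = e - m,    S = e^2 - 2 e m + m,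
      (S2)  w = (1 + m - 2 e)/k^2,  A = e/k^2,    S = (e^2 - m)/k^4.
    Hence every limit follows from explicit inequalities between e and k.  The delicate one
    is lambda -> 1 in (S2): there 1 - lambda is a multiple of the variance of
    Delta^2 + m/Delta^2, because <Delta^2> = e, <Delta^-2> = e/m and
    <Delta^4> = m^2 <Delta^-4> = (2 (1 + m) e - m)/3; the variance is bounded below by a
    multiple of k^8 e. *)

(** * The delta amplitude and its calculus *)

(** Legendre's delta amplitude: [dn u k] unfolds to [ellDelta k (am u k)], and K and E are the
    integrals of its inverse and of itself over a quarter turn. *)
Definition ellDelta (k theta : R) : R := sqrt (1 - k ^ 2 * sin theta ^ 2).

Lemma sin_sqr_cos_sqr (x : R) : sin x ^ 2 = 1 - cos x ^ 2.
Proof. pose proof (sin2_cos2 x) as H; unfold Rsqr in H; nra. Qed.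

Lemma one_minus_sin_sqr_pos (k theta : R) (hk : 0 < k < 1) :
  0 < 1 - k ^ 2 * sin theta ^ 2.
Proof.
  pose proof (sin2_cos2 theta) as H; unfold Rsqr in H.
  assert (sin theta ^ 2 <= 1) by nra.
  assert (0 <= sin theta ^ 2) by nra.
  assert (k ^ 2 < 1) by nra.
  nra.
Qed.

Lemma Delta_pos (k theta : R) (hk : 0 < k < 1) : 0 < ellDelta k theta.
Proof. apply sqrt_lt_R0, one_minus_sin_sqr_pos, hk. Qed.

Lemma Delta_sqr (k theta : R) (hk : 0 < k < 1) :
  ellDelta k theta ^ 2 = 1 - k ^ 2 * sin theta ^ 2.
Proof.
  unfold ellDelta; rewrite pow2_sqrt; [reflexivity|].
  left; apply one_minus_sin_sqr_pos, hk.
Qed.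

Lemma Delta_le_1 (k theta : R) : ellDelta k theta <= 1.
Proof.
  unfold ellDelta; rewrite <- sqrt_1 at 2; apply sqrt_le_1_alt.
  assert (0 <= (k * sin theta) ^ 2) by apply pow2_ge_0; nra.
Qed.

Lemma is_derive_Delta (k theta : R) (hk : 0 < k < 1) :
  is_derive (ellDelta k) theta (- k ^ 2 * sin theta * cos theta / ellDelta k theta).
Proof.
  pose proof (one_minus_sin_sqr_pos k theta hk) as H0.
  pose proof (Delta_pos k theta hk) as H1.
  unfold ellDelta in *; auto_derive; [simpl in *; lra|].
  replace (1 + - (k * (k * 1) * (sin theta * (sin theta * 1))))
    with (1 - k ^ 2 * sin theta ^ 2) by ring.
  field; lra.
Qed.

Lemma continuous_Delta (k theta : R) (hk : 0 < k < 1) :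
  continuous (ellDelta k) theta.
Proof.
  apply (ex_derive_continuous (ellDelta k)); eexists; apply is_derive_Delta, hk.
Qed.

Lemma continuous_Rinv_comp (f : R -> R) (x : R) :
  continuous f x -> f x <> 0 -> continuous (fun t => / f t) x.
Proof. intros hf h; apply continuous_comp; [exact hf|apply continuous_Rinv, h]. Qed.

Lemma continuous_inv_Delta (k theta : R) (hk : 0 < k < 1) :
  continuous (fun t => / ellDelta k t) theta.
Proof.
  apply continuous_Rinv_comp; [apply continuous_Delta, hk|].
  apply Rgt_not_eq, Delta_pos, hk.
Qed.

Lemma ex_RInt_of_continuous (f : R -> R) (a b : R) :
  (forall x, continuous f x) -> ex_RInt f a b.
Proof. intros h; apply (ex_RInt_continuous f); intros; apply h. Qed.

Lemma is_derive_primitive (f : R -> R) (a x : R) :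
  (forall x, continuous f x) -> is_derive (fun b => RInt f a b) x (f x).
Proof.
  intros h; apply (is_derive_RInt f (fun b => RInt f a b) a x); [|apply h].
  apply filter_forall; intros b.
  apply (RInt_correct f a b), ex_RInt_of_continuous, h.
Qed.

(** * The improper elliptic integrals as proper integrals over [0, pi/2] *)

Lemma is_derive_asin (x : R) : -1 < x < 1 -> is_derive asin x (/ sqrt (1 - x ^ 2)).
Proof.
  intros h; apply is_derive_Reals.
  pose proof (derive_pt_asin x h) as H.
  unfold derive_pt in H; destruct (derivable_pt_asin x h) as [l hl]; simpl in H.
  replace (/ sqrt (1 - x ^ 2)) with l; [exact hl|].
  rewrite H; unfold Rsqr, Rdiv; rewrite Rmult_1_l; do 2 f_equal; ring.
Qed.

(** The derivative of [asin] blows up at 1, so left continuity there is taken from the monotonicity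
    of [sin]: [b] above [sin (PI / 2 - d)] forces [asin b] above [PI / 2 - d]. *)
Lemma asin_left_limit (d : R) : 0 < d ->
  at_left 1 (fun b => 0 < b < 1 /\ PI / 2 - d < asin b < PI / 2).
Proof.
  intros hd; pose proof PI_RGT_0 as hpi.
  (* Capping at [PI / 2] keeps [PI / 2 - d'] in the range where [sin] is nonnegative and increasing,
     which also yields [0 < b]. *)
  set (d' := Rmin d (PI / 2)).
  assert (hd' : 0 < d') by (apply Rmin_glb_lt; lra).
  assert (hd1 : d' <= d) by apply Rmin_l.
  assert (hd2 : d' <= PI / 2) by apply Rmin_r.
  assert (hs : sin (PI / 2 - d') < 1).
  { rewrite <- sin_PI2; apply sin_increasing_1; lra. }
  assert (hs0 : 0 <= sin (PI / 2 - d')) by (apply sin_ge_0; lra).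
  assert (he : 0 < 1 - sin (PI / 2 - d')) by lra.
  exists (mkposreal _ he); intros b hb hb1; simpl in hb.
  unfold ball in hb; simpl in hb; unfold AbsRing_ball, abs, minus, plus, opp in hb.
  simpl in hb; apply Rabs_def2 in hb.
  assert (hb0 : 0 < b < 1) by lra.
  split; [exact hb0|].
  assert (hb2 : -1 < b < 1) by lra.
  pose proof (asin_bound_lt b hb2) as hab.
  split; [|lra].
  destruct (Rlt_or_le (PI / 2 - d') (asin b)) as [h|h]; [lra|exfalso].
  assert (sin (asin b) <= sin (PI / 2 - d')) by (apply sin_incr_1; lra).
  rewrite sin_asin in H; lra.
Qed.

(** The substitution t = sin theta absorbs the singularity at 1. On [0, b] with b < 1 the map
    [RInt f 0 (asin t)] is a primitive of [g]; the improper limit is then continuity of the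
    primitive of [f] at [PI / 2]. *)
Lemma RInt_gen_sin_subst (f g : R -> R) :
  (forall x, continuous f x) ->
  (forall t, -1 < t < 1 -> g t = f (asin t) * / sqrt (1 - t ^ 2)) ->
  RInt_gen g (at_point 0) (at_left 1) = RInt f 0 (PI / 2).
Proof.
  intros hf hg.
  apply (@is_RInt_gen_unique R_CompleteNormedModule).
  { apply Proper_StrongProper, at_point_filter. }
  { apply Proper_StrongProper, at_left_proper_filter. }
  assert (hd : forall b, -1 < b < 1 ->
    is_derive (fun t => RInt f 0 (asin t)) b (f (asin b) * / sqrt (1 - b ^ 2))).
  { intros b hb.
    pose proof (is_derive_comp (fun y => RInt f 0 y) asin b _ _
      (is_derive_primitive f 0 (asin b) hf) (is_derive_asin b hb)) as H.
    unfold scal in H; simpl in H; unfold mult in H; simpl in H.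
    rewrite Rmult_comm; exact H. }
  assert (hI : forall b, 0 < b < 1 -> is_RInt g 0 b (RInt f 0 (asin b))).
  { intros b hb.
    apply (is_RInt_ext (fun t => f (asin t) * / sqrt (1 - t ^ 2))).
    { intros t; rewrite Rmin_left, Rmax_right by lra; intros ht.
      symmetry; apply hg; lra. }
    replace (RInt f 0 (asin b)) with (minus (RInt f 0 (asin b)) (RInt f 0 (asin 0))).
    2:{ rewrite asin_0, RInt_point; unfold minus, plus, opp, zero; simpl; ring. }
    apply (is_RInt_derive (fun t => RInt f 0 (asin t))).
    - intros t; rewrite Rmin_left, Rmax_right by lra; intros ht; apply hd; lra.
    - intros t; rewrite Rmin_left, Rmax_right by lra; intros ht.
      assert (0 < 1 - t ^ 2) by nra.
      assert (0 < sqrt (1 - t ^ 2)) by (apply sqrt_lt_R0; assumption).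
      apply (continuous_mult (fun t => f (asin t)) (fun t => / sqrt (1 - t ^ 2))).
      + apply continuous_comp; [|apply hf].
        apply (ex_derive_continuous asin); eexists; apply is_derive_asin; lra.
      + apply (ex_derive_continuous (fun t => / sqrt (1 - t ^ 2))).
        auto_derive; replace (1 + - (t * (t * 1))) with (1 - t ^ 2) by ring;
          repeat split; lra. }
  assert (hc : continuous (fun y => RInt f 0 y) (PI / 2)).
  { apply (ex_derive_continuous (fun y => RInt f 0 y)); eexists.
    apply is_derive_primitive, hf. }
  intros P hP; unfold filtermapi.
  specialize (hc P hP); destruct hc as [d hd'].
  apply (Filter_prod (at_point 0) (at_left 1) _ (fun x => x = 0)
    (fun b => 0 < b < 1 /\ PI / 2 - d < asin b < PI / 2)).
  - reflexivity.
  - apply asin_left_limit, cond_pos.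
  - intros x b hx [hb hab]; subst x; exists (RInt f 0 (asin b)); split.
    + apply hI, hb.
    + apply hd'; unfold ball; simpl; unfold AbsRing_ball, abs, minus, plus, opp; simpl.
      apply Rabs_def1; lra.
Qed.

Lemma Delta_asin (k t : R) : -1 < t < 1 -> ellDelta k (asin t) = sqrt (1 - k ^ 2 * t ^ 2).
Proof. intros h; unfold ellDelta; rewrite sin_asin; [reflexivity|lra]. Qed.

Lemma ellK_RInt (k : R) (hk : 0 < k < 1) :
  ellK k = RInt (fun t => / ellDelta k t) 0 (PI / 2).
Proof.
  unfold ellK; apply (RInt_gen_sin_subst (fun t => / ellDelta k t)).
  - intros; apply continuous_inv_Delta, hk.
  - intros t ht; rewrite Delta_asin by exact ht.
    rewrite sqrt_mult_alt, Rinv_mult by nra; ring.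
Qed.

Lemma ellE_RInt (k : R) (hk : 0 < k < 1) :
  ellE k = RInt (ellDelta k) 0 (PI / 2).
Proof.
  unfold ellE; apply (RInt_gen_sin_subst (ellDelta k)).
  - intros; apply continuous_Delta, hk.
  - intros t ht; rewrite Delta_asin by exact ht.
    assert (0 < 1 - t ^ 2) by nra.
    rewrite sqrt_div_alt; [reflexivity|exact H].
Qed.

(** * Reduction formulas for integrals of powers of the delta amplitude *)

Lemma is_RInt_linear_combination (f g : R -> R) (a b c d If Ig : R) :
  is_RInt f a b If -> is_RInt g a b Ig ->
  is_RInt (fun x => c * f x + d * g x) a b (c * If + d * Ig).
Proof.
  intros hf hg.
  apply (is_RInt_plus (fun x => c * f x) (fun x => d * g x)).
  - apply (is_RInt_scal f _ _ c), hf.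
  - apply (is_RInt_scal g _ _ d), hg.
Qed.

Lemma is_RInt_antiderivative (G g : R -> R) (a b : R) :
  (forall x, is_derive G x (g x)) -> (forall x, continuous g x) ->
  is_RInt g a b (G b - G a).
Proof.
  intros hG hg; apply (is_RInt_derive G g); intros; [apply hG|apply hg].
Qed.

Lemma RInt_ge_on_subinterval (f : R -> R) (a b c d q : R) :
  a <= c -> c <= d -> d <= b -> (forall x, continuous f x) ->
  (forall x, 0 <= f x) -> (forall x, c < x < d -> q <= f x) ->
  q * (d - c) <= RInt f a b.
Proof.
  intros hac hcd hdb hf hpos hq.
  pose proof (fun u v => ex_RInt_of_continuous f u v hf) as hex.
  rewrite <- (RInt_Chasles f a c b) by apply hex.
  rewrite <- (RInt_Chasles f c d b) by apply hex.
  unfold plus; simpl.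
  assert (h1 : 0 <= RInt f a c) by (apply RInt_ge_0; auto).
  assert (h2 : 0 <= RInt f d b) by (apply RInt_ge_0; auto).
  assert (h3 : RInt (fun _ => q) c d <= RInt f c d).
  { apply RInt_le; [exact hcd|apply ex_RInt_const|apply hex|exact hq]. }
  rewrite RInt_const in h3; unfold scal in h3; simpl in h3; unfold mult in h3.
  simpl in h3; lra.
Qed.

Lemma is_RInt_ellK (k : R) (hk : 0 < k < 1) :
  is_RInt (fun t => / ellDelta k t) 0 (PI / 2) (ellK k).
Proof.
  rewrite ellK_RInt by exact hk.
  apply (RInt_correct (fun t => / ellDelta k t)), ex_RInt_of_continuous.
  intros; apply continuous_inv_Delta, hk.
Qed.

Lemma is_RInt_ellE (k : R) (hk : 0 < k < 1) :
  is_RInt (ellDelta k) 0 (PI / 2) (ellE k).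
Proof.
  rewrite ellE_RInt by exact hk.
  apply (RInt_correct (ellDelta k)), ex_RInt_of_continuous.
  intros; apply continuous_Delta, hk.
Qed.

Lemma continuous_comp_Delta (k : R) (hk : 0 < k < 1) (phi : R -> R) :
  (forall d, 0 < d -> ex_derive phi d) ->
  forall t, continuous (fun t => phi (ellDelta k t)) t.
Proof.
  intros hphi t; apply continuous_comp; [apply continuous_Delta, hk|].
  apply (ex_derive_continuous phi), hphi, Delta_pos, hk.
Qed.

Ltac nonzero :=
  repeat split; repeat apply Rmult_integral_contrapositive_currified; lra.

(** Restates an equality at the type [R] itself instead of a module carrier convertible to it, so
    that the ring tactics recognise it. *)
Ltac eqR := match goal with |- ?a = ?b => change (@eq R a b) end.

(** The closing [field [hc hs]] works modulo the two relations that express [cos x ^ 2] and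
    [ellDelta k x ^ 2] through [sin x ^ 2]. *)
Ltac auto_derive_Delta hk x :=
  pose proof (is_derive_Delta _ x hk) as hD;
  pose proof (Delta_pos _ x hk) as hp;
  pose proof (Delta_sqr _ x hk) as hs;
  assert (hc : cos x ^ 2 = 1 - sin x ^ 2) by (rewrite sin_sqr_cos_sqr; ring);
  auto_derive;
  [ repeat split; try (eexists; exact hD); nonzero
  | match goal with |- context [Derive ?f x] =>
      rewrite (is_derive_unique f x _ hD) end;
    field [hc hs]; nonzero ].

(** The function [G], sin cos / Delta, vanishes at both ends and has derivative
    [phi (ellDelta k x)]. Integrating it gives E = (1 - k^2) times the integral of Delta^-3. The
    next two lemmas use sin cos Delta and sin cos / Delta^3 in the same way. *)
Lemma is_RInt_inv_Delta_cube (k : R) (hk : 0 < k < 1) :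
  is_RInt (fun t => / ellDelta k t ^ 3) 0 (PI / 2) (ellE k / (1 - k ^ 2)).
Proof.
  assert (hm : 0 < 1 - k ^ 2) by nra.
  pose (phi := fun d => / k ^ 2 * (d - (1 - k ^ 2) * / d ^ 3)).
  assert (hg : is_RInt (fun t => phi (ellDelta k t)) 0 (PI / 2) 0).
  { pose (G := fun t => sin t * cos t * / ellDelta k t).
    (* The second 0 is the value of the integral; the first is its lower limit. *)
    replace 0 with (G (PI / 2) - G 0) at 2 by
      (unfold G; rewrite sin_0, cos_PI2; ring).
    apply is_RInt_antiderivative.
    - intros x; unfold G, phi; auto_derive_Delta hk x.
    - apply continuous_comp_Delta; [exact hk|].
      intros d hd; unfold phi; auto_derive; nonzero. }
  pose proof (is_RInt_linear_combination _ _ _ _ (/ (1 - k ^ 2)) (- k ^ 2 / (1 - k ^ 2)) _ _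
    (is_RInt_ellE k hk) hg) as H.
  replace (ellE k / (1 - k ^ 2)) with
    (/ (1 - k ^ 2) * ellE k + - k ^ 2 / (1 - k ^ 2) * 0) by (field; lra).
  revert H; apply is_RInt_ext; intros x _; unfold phi; eqR.
  pose proof (Delta_pos k x hk); field; repeat split; lra.
Qed.

Lemma is_RInt_Delta_cube (k : R) (hk : 0 < k < 1) :
  is_RInt (fun t => ellDelta k t ^ 3) 0 (PI / 2)
    ((2 * (2 - k ^ 2) * ellE k - (1 - k ^ 2) * ellK k) / 3).
Proof.
  pose (phi := fun d => / k ^ 2 * (3 * d ^ 3 - 2 * (2 - k ^ 2) * d + (1 - k ^ 2) * / d)).
  assert (hg : is_RInt (fun t => phi (ellDelta k t)) 0 (PI / 2) 0).
  { pose (G := fun t => sin t * cos t * ellDelta k t).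
    replace 0 with (G (PI / 2) - G 0) at 2 by
      (unfold G; rewrite sin_0, cos_PI2; ring).
    apply is_RInt_antiderivative.
    - intros x; unfold G, phi; auto_derive_Delta hk x.
    - apply continuous_comp_Delta; [exact hk|].
      intros d hd; unfold phi; auto_derive; nonzero. }
  pose proof (is_RInt_linear_combination _ _ _ _ (2 * (2 - k ^ 2) / 3) (- (1 - k ^ 2) / 3)
    _ _ (is_RInt_ellE k hk) (is_RInt_ellK k hk)) as H0.
  pose proof (is_RInt_linear_combination _ _ _ _ 1 (k ^ 2 / 3) _ _ H0 hg) as H.
  replace ((2 * (2 - k ^ 2) * ellE k - (1 - k ^ 2) * ellK k) / 3) with
    (1 * (2 * (2 - k ^ 2) / 3 * ellE k + - (1 - k ^ 2) / 3 * ellK k) + k ^ 2 / 3 * 0)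
    by field.
  revert H; apply is_RInt_ext; intros x _; unfold phi; eqR.
  pose proof (Delta_pos k x hk); field; repeat split; lra.
Qed.

Lemma is_RInt_inv_Delta_pow5 (k : R) (hk : 0 < k < 1) :
  is_RInt (fun t => / ellDelta k t ^ 5) 0 (PI / 2)
    ((2 * (2 - k ^ 2) * ellE k - (1 - k ^ 2) * ellK k) / (3 * (1 - k ^ 2) ^ 2)).
Proof.
  assert (hm : 0 < 1 - k ^ 2) by nra.
  pose (phi := fun d => / k ^ 2 *
    (- / d + 2 * (2 - k ^ 2) * / d ^ 3 - 3 * (1 - k ^ 2) * / d ^ 5)).
  assert (hg : is_RInt (fun t => phi (ellDelta k t)) 0 (PI / 2) 0).
  { pose (G := fun t => sin t * cos t * / ellDelta k t ^ 3).
    replace 0 with (G (PI / 2) - G 0) at 2 by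
      (unfold G; rewrite sin_0, cos_PI2; ring).
    apply is_RInt_antiderivative.
    - intros x; unfold G, phi; auto_derive_Delta hk x.
    - apply continuous_comp_Delta; [exact hk|].
      intros d hd; unfold phi; auto_derive; nonzero. }
  pose proof (is_RInt_linear_combination _ _ _ _ (2 * (2 - k ^ 2) / (3 * (1 - k ^ 2)))
    (- / (3 * (1 - k ^ 2))) _ _ (is_RInt_inv_Delta_cube k hk) (is_RInt_ellK k hk)) as H0.
  pose proof (is_RInt_linear_combination _ _ _ _ 1 (- k ^ 2 / (3 * (1 - k ^ 2))) _ _ H0 hg)
    as H.
  match type of H with is_RInt _ _ _ ?v =>
    replace ((2 * (2 - k ^ 2) * ellE k - (1 - k ^ 2) * ellK k) / (3 * (1 - k ^ 2) ^ 2))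
      with v by (field; lra) end.
  revert H; apply is_RInt_ext; intros x _; unfold phi; eqR.
  pose proof (Delta_pos k x hk); field; repeat split; lra.
Qed.

Lemma is_RInt_sin_sqr : is_RInt (fun t => sin t ^ 2) 0 (PI / 2) (PI / 4).
Proof.
  pose (G := fun t => (t - sin t * cos t) / 2).
  replace (PI / 4) with (G (PI / 2) - G 0) by
    (unfold G; rewrite sin_0, cos_PI2; field).
  apply is_RInt_antiderivative; intros x.
  - unfold G; pose proof (sin_sqr_cos_sqr x); auto_derive; [exact I|]; eqR; simpl in *; nra.
  - apply (ex_derive_continuous (fun t => sin t ^ 2)); auto_derive; exact I.
Qed.

Lemma is_RInt_sin_pow4 : is_RInt (fun t => sin t ^ 4) 0 (PI / 2) (3 * PI / 16).
Proof.
  pose (G := fun t => 3 * t / 8 - 3 * sin t * cos t / 8 - sin t ^ 3 * cos t / 4).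
  replace (3 * PI / 16) with (G (PI / 2) - G 0) by
    (unfold G; rewrite sin_0, cos_PI2; field).
  apply is_RInt_antiderivative; intros x.
  - assert (hc : cos x ^ 2 = 1 - sin x ^ 2) by (rewrite sin_sqr_cos_sqr; ring).
    unfold G; auto_derive; [exact I|]; eqR; field [hc].
  - apply (ex_derive_continuous (fun t => sin t ^ 4)); auto_derive; exact I.
Qed.

(** * Inequalities between E, K and the modulus *)

Lemma is_RInt_constR (c : R) : is_RInt (fun _ => c) 0 (PI / 2) (PI / 2 * c).
Proof.
  replace (PI / 2 * c) with (scal (PI / 2 - 0) c); [apply (is_RInt_const 0 (PI / 2) c)|].
  unfold scal; simpl; unfold mult; simpl; ring.
Qed.

Lemma inv_Delta_ge_1 (k x : R) (hk : 0 < k < 1) : 1 <= / ellDelta k x.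
Proof.
  rewrite <- Rinv_1; apply Rinv_le_contravar; [apply Delta_pos, hk|apply Delta_le_1].
Qed.

Lemma ellK_ge (k : R) (hk : 0 < k < 1) : PI / 2 <= ellK k.
Proof.
  pose proof PI_RGT_0.
  rewrite <- (Rmult_1_r (PI / 2)).
  apply (is_RInt_le (fun _ => 1) (fun t => / ellDelta k t) 0 (PI / 2));
    [lra|apply is_RInt_constR|apply is_RInt_ellK, hk|].
  intros x _; apply inv_Delta_ge_1, hk.
Qed.

Lemma ellE_le (k : R) (hk : 0 < k < 1) : ellE k <= PI / 2.
Proof.
  pose proof PI_RGT_0.
  rewrite <- (Rmult_1_r (PI / 2)).
  apply (is_RInt_le (ellDelta k) (fun _ => 1) 0 (PI / 2));
    [lra|apply is_RInt_ellE, hk|apply is_RInt_constR|].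
  intros x _; apply Delta_le_1.
Qed.

Lemma Delta_sqr_bounds (k x : R) (hk : 0 < k < 1) :
  1 - k ^ 2 <= ellDelta k x ^ 2 <= 1.
Proof.
  rewrite Delta_sqr by exact hk.
  assert (0 <= sin x ^ 2) by apply pow2_ge_0.
  assert (0 <= cos x ^ 2) by apply pow2_ge_0.
  pose proof (sin_sqr_cos_sqr x).
  assert (0 <= k ^ 2) by apply pow2_ge_0.
  nra.
Qed.

Lemma compl_ellK_le (k : R) (hk : 0 < k < 1) : (1 - k ^ 2) * ellK k <= PI / 2.
Proof.
  pose proof PI_RGT_0.
  rewrite <- (Rmult_1_r (PI / 2)).
  apply (is_RInt_le (fun t => (1 - k ^ 2) * / ellDelta k t) (fun _ => 1) 0 (PI / 2));
    [lra| |apply is_RInt_constR|].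
  - apply (is_RInt_scal (fun t => / ellDelta k t) _ _ (1 - k ^ 2)), is_RInt_ellK, hk.
  - intros x _; pose proof (Delta_pos k x hk); pose proof (Delta_sqr_bounds k x hk).
    pose proof (Delta_le_1 k x).
    apply (Rmult_le_reg_r (ellDelta k x)); [lra|].
    rewrite Rmult_assoc, Rinv_l by lra; nra.
Qed.

(** The integrand Delta - (1 - k^2) / Delta equals k^2 cos^2 / Delta, which is at least k^2 cos^2
    because Delta <= 1. *)
Lemma ellE_minus_ellK_ge (k : R) (hk : 0 < k < 1) :
  k ^ 2 * (PI / 4) <= ellE k - (1 - k ^ 2) * ellK k.
Proof.
  pose proof PI_RGT_0.
  pose proof (is_RInt_linear_combination _ _ _ _ (k ^ 2) (- k ^ 2) _ _ (is_RInt_constR 1)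
    is_RInt_sin_sqr) as H1.
  pose proof (is_RInt_linear_combination _ _ _ _ 1 (- (1 - k ^ 2)) _ _ (is_RInt_ellE k hk)
    (is_RInt_ellK k hk)) as H2.
  refine (Rle_trans _ _ _ _ (Rle_trans _ _ _
    (is_RInt_le _ _ 0 (PI / 2) _ _ _ H1 H2 _) _)); try lra.
  intros x _; pose proof (Delta_pos k x hk); pose proof (Delta_sqr k x hk) as hs.
  pose proof (Delta_le_1 k x).
  apply (Rmult_le_reg_r (ellDelta k x)); [lra|].
  assert (0 <= cos x ^ 2) by apply pow2_ge_0.
  pose proof (sin_sqr_cos_sqr x).
  assert (0 <= k ^ 2) by apply pow2_ge_0.
  replace ((1 * ellDelta k x + - (1 - k ^ 2) * / ellDelta k x) * ellDelta k x)
    with (k ^ 2 * (1 - sin x ^ 2)).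
  - assert (0 <= k ^ 2 * (1 - sin x ^ 2)) by nra; nra.
  - field_simplify; [rewrite hs; ring|lra].
Qed.

(** Write 2 E as the integral of Delta + (1 - k^2) / Delta^3. Its integrand is below (2 - k^2) /
    Delta because (1 - Delta^2) (Delta^2 - (1 - k^2)) >= 0. *)
Lemma ellE_le_mean (k : R) (hk : 0 < k < 1) :
  2 * ellE k <= (2 - k ^ 2) * ellK k.
Proof.
  pose proof PI_RGT_0; assert (hm : 0 < 1 - k ^ 2) by nra.
  pose proof (is_RInt_linear_combination _ _ _ _ 1 (1 - k ^ 2) _ _ (is_RInt_ellE k hk)
    (is_RInt_inv_Delta_cube k hk)) as H1.
  pose proof (is_RInt_scal _ _ _ (2 - k ^ 2) _ (is_RInt_ellK k hk)) as H2.
  replace (2 * ellE k) with (1 * ellE k + (1 - k ^ 2) * (ellE k / (1 - k ^ 2)))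
    by (field; lra).
  apply (is_RInt_le _ _ 0 (PI / 2) _ _ ltac:(lra) H1 H2).
  intros x _; pose proof (Delta_pos k x hk) as hp.
  pose proof (Delta_sqr_bounds k x hk) as hb.
  unfold scal; simpl; unfold mult; simpl.
  assert (hp3 : 0 < ellDelta k x ^ 3) by (apply pow_lt; exact hp).
  apply (Rmult_le_reg_r (ellDelta k x ^ 3)); [exact hp3|].
  apply Rminus_le.
  match goal with |- ?a <= 0 => replace a with
    (- ((1 - ellDelta k x ^ 2) * (ellDelta k x ^ 2 - (1 - k ^ 2)))) by (field; lra) end.
  nra.
Qed.

(* The integrand (Delta - k'/Delta)^2 / Delta integrates to 2 (E - k' K), with k' = c. *)
Lemma ellE_minus_compl_ellK_ge (k c : R) (hk : 0 < k < 1)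
    (hc : 0 < c) (hck : c ^ 2 = 1 - k ^ 2) :
  (1 - c) ^ 2 * PI / 12 <= ellE k - c * ellK k.
Proof.
  pose proof PI_RGT_0.
  assert (hc1 : c < 1) by nra.
  pose proof (is_RInt_linear_combination _ _ _ _ ((1 - c) ^ 2) (- (2 * (1 - c) * k ^ 2)) _ _
    (is_RInt_constR 1) is_RInt_sin_sqr) as H1a.
  pose proof (is_RInt_linear_combination _ _ _ _ 1 (k ^ 4) _ _ H1a is_RInt_sin_pow4) as H1.
  pose proof (is_RInt_linear_combination _ _ _ _ 1 (1 - k ^ 2) _ _ (is_RInt_ellE k hk)
    (is_RInt_inv_Delta_cube k hk)) as H2a.
  pose proof (is_RInt_linear_combination _ _ _ _ 1 (- (2 * c)) _ _ H2a
    (is_RInt_ellK k hk)) as H2.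
  assert (hle := fun h => is_RInt_le _ _ 0 (PI / 2) _ _ ltac:(lra) H1 H2 h).
  assert (hk4 : k ^ 4 = (1 - c ^ 2) ^ 2) by (rewrite hck; ring).
  assert (hk2 : k ^ 2 = 1 - c ^ 2) by (rewrite hck; ring).
  lapply hle.
  - clear hle H1 H2 H1a H2a; rewrite hk4, hk2; intros h.
    replace (1 - (1 - c ^ 2)) with (c ^ 2) in h by ring.
    replace (1 * (1 * ellE k + c ^ 2 * (ellE k / c ^ 2)) + - (2 * c) * ellK k)
      with (2 * (ellE k - c * ellK k)) in h by (field; lra).
    (* The lower integral is pi (1 - c)^2 (3 c^2 - 2 c + 3) / 16, and 3 (3 c^2 - 2 c + 3) = (3 c -
       1)^2 + 8; dropping the square leaves twice the constant pi / 12. *)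
    assert (0 <= (1 - c) ^ 2 * PI * (3 * c - 1) ^ 2).
    { apply Rmult_le_pos; [apply Rmult_le_pos; [apply pow2_ge_0|lra]|apply pow2_ge_0]. }
    nra.
  - intros x _; clear hle H1 H2 H1a H2a.
    pose proof (Delta_pos k x hk) as hp; pose proof (Delta_sqr k x hk) as hs.
    pose proof (Delta_le_1 k x) as h1.
    rewrite hk4, <- hck; rewrite hk2 in *.
    assert (hp3 : 0 < ellDelta k x ^ 3) by (apply pow_lt; exact hp).
    assert (hp31 : ellDelta k x ^ 3 <= 1).
    { rewrite <- (pow1 3); apply pow_incr; lra. }
    set (D := ellDelta k x) in *.
    (* The lower integrand is (Delta^2 - c)^2 and the upper one is the same square divided by
       Delta^3, which is at most 1. *)
    apply (Rmult_le_reg_r (D ^ 3)); [exact hp3|].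
    replace ((1 * (1 * D + c ^ 2 * / D ^ 3) + - (2 * c) * / D) * D ^ 3)
      with ((D ^ 2 - c) ^ 2) by (field; lra).
    match goal with |- ?a * _ <= _ => replace a with ((D ^ 2 - c) ^ 2) end.
    + assert (0 <= (D ^ 2 - c) ^ 2) by apply pow2_ge_0; nra.
    + rewrite hs; ring.
Qed.

(** This is (1 - Delta^2) (Delta^2 - (1 - k^2)) = k^4 sin^2 cos^2 divided by Delta^2. It isolates
    the non-constant part, with an explicit factor k^4, for the variance bound. *)
Lemma Delta_sqr_plus_compl (k x : R) (hk : 0 < k < 1) :
  ellDelta k x ^ 2 + (1 - k ^ 2) / ellDelta k x ^ 2
  = 2 - k ^ 2 - k ^ 4 * (sin x ^ 2 * cos x ^ 2 / ellDelta k x ^ 2).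
Proof.
  pose proof (Delta_pos k x hk) as hp; pose proof (Delta_sqr k x hk) as hs.
  assert (hc : cos x ^ 2 = 1 - sin x ^ 2) by (rewrite sin_sqr_cos_sqr; ring).
  field [hs hc]; lra.
Qed.

(** Here cos^2 <= Delta^2 and sin x < x. Together with the next lemma this provides two ranges on
    which the quantity differs by at least 1/8, whatever the modulus. *)
Lemma sin_cos_Delta_small (k x : R) (hk : 0 < k < 1) :
  0 < x < 1 / 4 -> sin x ^ 2 * cos x ^ 2 / ellDelta k x ^ 2 <= 1 / 16.
Proof.
  intros hx; pose proof (Delta_pos k x hk) as hp; pose proof (Delta_sqr k x hk) as hs.
  assert (hc : cos x ^ 2 = 1 - sin x ^ 2) by (rewrite sin_sqr_cos_sqr; ring).
  assert (hsx : 0 < sin x < x).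
  { pose proof PI2_3_2; split; [apply sin_gt_0; lra|apply sin_lt_x; lra]. }
  assert (0 <= cos x ^ 2) by apply pow2_ge_0.
  assert (hD : 0 < ellDelta k x ^ 2) by (apply pow_lt; exact hp).
  apply (Rmult_le_reg_r (ellDelta k x ^ 2)); [exact hD|].
  replace (sin x ^ 2 * cos x ^ 2 / ellDelta k x ^ 2 * ellDelta k x ^ 2)
    with (sin x ^ 2 * cos x ^ 2) by (field; lra).
  assert (hk2 : k ^ 2 <= 1) by nra.
  assert (cos x ^ 2 <= ellDelta k x ^ 2).
  { rewrite hs, hc; assert (0 <= sin x ^ 2) by apply pow2_ge_0; nra. }
  assert (sin x ^ 2 <= 1 / 16) by nra.
  apply Rmult_le_compat; try apply pow2_ge_0; assumption.
Qed.

(** Both sin^2 and cos^2 are at least 1/4 and sum to 1, so their product is at least 3/16; dividing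
    by Delta^2 <= 1 only increases it. *)
Lemma sin_cos_Delta_large (k x : R) (hk : 0 < k < 1) :
  PI / 6 < x < PI / 3 -> 3 / 16 <= sin x ^ 2 * cos x ^ 2 / ellDelta k x ^ 2.
Proof.
  intros hx; pose proof (Delta_pos k x hk) as hp.
  pose proof PI_RGT_0.
  assert (h1 : 1 / 2 <= sin x) by (rewrite <- sin_PI6; apply sin_incr_1; lra).
  assert (h2 : 1 / 2 <= cos x) by (rewrite <- cos_PI3; apply cos_decr_1; lra).
  pose proof (sin_sqr_cos_sqr x) as hsc.
  assert (hs2 : 1 / 4 <= sin x ^ 2) by nra.
  assert (hc2 : 1 / 4 <= cos x ^ 2) by nra.
  assert (h3 : 3 / 16 <= sin x ^ 2 * cos x ^ 2).
  { set (s := sin x ^ 2) in *; set (c := cos x ^ 2) in *; clearbody s c; nra. }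
  assert (hD : 0 < ellDelta k x ^ 2) by (apply pow_lt; exact hp).
  pose proof (Delta_sqr_bounds k x hk).
  apply (Rmult_le_reg_r (ellDelta k x ^ 2)); [exact hD|].
  replace (sin x ^ 2 * cos x ^ 2 / ellDelta k x ^ 2 * ellDelta k x ^ 2)
    with (sin x ^ 2 * cos x ^ 2) by (field; lra).
  nra.
Qed.

(* The left-hand side is K/4 times the variance of Delta^2 + k'^2 / Delta^2 under
   the probability density 1 / (K Delta). *)
Lemma ellE_ellK_variance_ge (k : R) (hk : 0 < k < 1) :
  k ^ 8 / 1024 <=
  4 * (((2 - k ^ 2) * ellE k + (1 - k ^ 2) * ellK k) / 3 - ellE k ^ 2 / ellK k).
Proof.
  pose proof PI_RGT_0; assert (hm : 0 < 1 - k ^ 2) by nra.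
  assert (hK : 0 < ellK k) by (pose proof (ellK_ge k hk); lra).
  (* The mean of Delta^2 + (1 - k^2) / Delta^2 for the density 1 / (K Delta): both terms contribute
     E / K. *)
  set (a := 2 * ellE k / ellK k).
  (* The squared deviation without the weight 1 / Delta; the weight is at least 1, so dropping it
     gives a lower bound. *)
  pose (phi := fun d => (d ^ 2 + (1 - k ^ 2) / d ^ 2 - a) ^ 2).
  assert (hphi : forall t, continuous (fun t => phi (ellDelta k t)) t).
  { apply continuous_comp_Delta; [exact hk|].
    intros d hd; unfold phi; auto_derive; nonzero. }
  pose proof (RInt_correct _ 0 (PI / 2) (ex_RInt_of_continuous _ 0 (PI / 2) hphi)) as H1.
  pose proof (is_RInt_linear_combination _ _ _ _ 1 ((1 - k ^ 2) ^ 2) _ _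
    (is_RInt_Delta_cube k hk) (is_RInt_inv_Delta_pow5 k hk)) as H2a.
  pose proof (is_RInt_linear_combination _ _ _ _ 1 (1 - k ^ 2) _ _ (is_RInt_ellE k hk)
    (is_RInt_inv_Delta_cube k hk)) as H2b.
  pose proof (is_RInt_linear_combination _ _ _ _ 1 (- (2 * a)) _ _ H2a H2b) as H2c.
  pose proof (is_RInt_linear_combination _ _ _ _ 1 (2 * (1 - k ^ 2) + a ^ 2) _ _ H2c
    (is_RInt_ellK k hk)) as H2.
  assert (hle := fun h => is_RInt_le _ _ 0 (PI / 2) _ _ ltac:(lra) H1 H2 h).
  lapply hle.
  2:{ intros x _; unfold phi.
      pose proof (Delta_pos k x hk) as hp; pose proof (inv_Delta_ge_1 k x hk) as hi.
      set (D := ellDelta k x) in *.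
      apply (Rle_trans _ ((D ^ 2 + (1 - k ^ 2) / D ^ 2 - a) ^ 2 * / D)).
      - assert (0 <= (D ^ 2 + (1 - k ^ 2) / D ^ 2 - a) ^ 2) by apply pow2_ge_0; nra.
      - right; field; lra. }
  clear hle H1 H2 H2a H2b H2c; intros hle.
  match type of hle with _ <= ?v => replace v with
    (4 * (((2 - k ^ 2) * ellE k + (1 - k ^ 2) * ellK k) / 3 - ellE k ^ 2 / ellK k)) in hle end.
  2:{ unfold a; field; lra. }
  refine (Rle_trans _ _ _ _ hle); clear hle.
  pose proof PI2_3_2 as hpi.
  assert (hk4 : 0 < k ^ 4) by (apply pow_lt; lra).
  assert (hk8 : k ^ 8 = k ^ 4 * k ^ 4) by ring.
  assert (hpos : forall x, 0 <= phi (ellDelta k x)) by (intros; apply pow2_ge_0).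
  (* The deviation is [2 - k ^ 2 - a - k ^ 4 * y]. The threshold 1/8 is midway between 1/16 and
     3/16, so on one of the two ranges the deviation is at least [k ^ 4 / 16] in absolute value. The
     shorter range has length 1/4, whence [k ^ 8 / 1024]. *)
  destruct (Rle_or_lt (k ^ 4 / 8) (2 - k ^ 2 - a)) as [h|h].
  - refine (Rle_trans _ _ _ _ (RInt_ge_on_subinterval _ 0 (PI / 2) 0 (1 / 4)
      ((k ^ 4 / 16) ^ 2) _ _ _ hphi hpos _)); try lra.
    intros x hx; unfold phi; rewrite Delta_sqr_plus_compl by exact hk.
    pose proof (sin_cos_Delta_small k x hk hx) as hy.
    set (y := sin x ^ 2 * cos x ^ 2 / ellDelta k x ^ 2) in *.
    apply pow_incr; nra.
  - refine (Rle_trans _ _ _ _ (RInt_ge_on_subinterval _ 0 (PI / 2) (PI / 6) (PI / 3)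
      ((k ^ 4 / 16) ^ 2) _ _ _ hphi hpos _)); try lra.
    + assert (0 < k ^ 4 * k ^ 4) by nra; nra.
    + intros x hx; unfold phi; rewrite Delta_sqr_plus_compl by exact hk.
      pose proof (sin_cos_Delta_large k x hk hx) as hy.
      set (y := sin x ^ 2 * cos x ^ 2 / ellDelta k x ^ 2) in *.
      rewrite <- (Rsqr_pow2 (_ - a)), Rsqr_neg, Rsqr_pow2.
      apply pow_incr; nra.
Qed.

Lemma sqr_compl_pos (k : R) (hk : 0 < k < 1) :
  0 < sqrt (1 - k ^ 2) < 1 /\ sqrt (1 - k ^ 2) ^ 2 = 1 - k ^ 2.
Proof.
  assert (hm : 0 < 1 - k ^ 2) by nra.
  assert (h := pow2_sqrt (1 - k ^ 2) ltac:(lra)).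
  pose proof (sqrt_lt_R0 _ hm); split; [split; [assumption|]|exact h].
  nra.
Qed.

(** The preceding bounds made homogeneous by dividing by K, with E <= pi/2 and m K <= pi/2 trading
    pi for E or m K. The 6 is 12 / 2; the 2731 rounds up 2 * 1024 * 4 / 3, where E is bounded by
    2. *)
Lemma ellE_ellK_ratio_bounds (k : R) (hk : 0 < k < 1) :
  let m := 1 - k ^ 2 in
  let e := ellE k / ellK k in
  let c := sqrt m in
  0 < m < 1 /\ 0 < c < 1 /\ c ^ 2 = m /\
  m < e /\ 2 * e <= 1 + m /\ k ^ 2 * m <= 2 * (e - m) /\ c < e /\
  (1 - c) ^ 2 * e <= 6 * (e - c) /\
  k ^ 8 * e <= 2731 * ((1 + m) * e + m - 3 * e ^ 2).
Proof.
  intros m e c.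
  pose proof PI_RGT_0; assert (hm : 0 < m < 1) by (unfold m; split; nra).
  assert (hK : 0 < ellK k) by (pose proof (ellK_ge k hk); lra).
  destruct (sqr_compl_pos k hk) as [hc hc2]; fold m c in hc, hc2.
  assert (hE : ellE k = e * ellK k) by (unfold e; field; lra).
  pose proof (ellE_le k hk) as h1; pose proof (ellK_ge k hk) as h2.
  pose proof (compl_ellK_le k hk) as h3; pose proof (ellE_minus_ellK_ge k hk) as h4.
  pose proof (ellE_le_mean k hk) as h5.
  pose proof (ellE_minus_compl_ellK_ge k c hk (proj1 hc) hc2) as h6.
  pose proof (ellE_ellK_variance_ge k hk) as h7.
  assert (hk2 : 0 < k ^ 2 < 1) by (split; nra).
  assert (hkm : k ^ 2 = 1 - m) by (unfold m; ring).
  fold m in h3, h4.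
  assert (hE2 : ellE k ^ 2 / ellK k = e ^ 2 * ellK k) by (rewrite hE; field; lra).
  rewrite hE2 in h7; clear hE2.
  replace (2 - k ^ 2) with (1 + m) in * by (unfold m; ring).
  fold m in h7.
  rewrite hE in *; set (K := ellK k) in *; clearbody K.
  assert (he : m < e).
  { apply (Rmult_lt_reg_r K); [exact hK|]; nra. }
  assert (hce : (1 - c) ^ 2 * e <= 6 * (e - c)).
  { apply (Rmult_le_reg_r K); [exact hK|].
    apply (Rle_trans _ ((1 - c) ^ 2 * (PI / 2))); [|lra].
    rewrite Rmult_assoc; apply Rmult_le_compat_l; [apply pow2_ge_0|lra]. }
  repeat split; try lra; try assumption.
  - apply (Rmult_le_reg_r K); [exact hK|]; lra.
  - apply (Rmult_le_reg_r K); [exact hK|].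
    assert (k ^ 2 * (m * K) <= k ^ 2 * (PI / 2)) by (apply Rmult_le_compat_l; lra).
    lra.
  - assert (0 < (1 - c) ^ 2) by (apply pow_lt; lra); nra.
  - apply (Rmult_le_reg_r K); [exact hK|].
    assert (hk8 : 0 < k ^ 8) by (apply pow_lt; lra).
    pose proof PI_4.
    assert (k ^ 8 * (e * K) <= k ^ 8 * 2) by (apply Rmult_le_compat_l; lra).
    lra.
Qed.

(** * Limits from explicit rates *)

Lemma filterlim_at_right_linear (f : R -> R) (a d l C : R) :
  0 < d -> (forall x, a < x < a + d -> Rabs (f x - l) <= C * (x - a)) ->
  filterlim f (at_right a) (locally l).
Proof.
  intros hd hf; apply filterlim_locally; intros eps.
  pose proof (cond_pos eps) as he; pose proof (Rabs_pos C) as hC.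
  (* [Rabs C + 1] is a positive divisor that dominates [C] whatever its sign. *)
  assert (hr : 0 < Rmin d (eps / (Rabs C + 1))).
  { apply Rmin_glb_lt; [lra|apply Rdiv_lt_0_compat; lra]. }
  exists (mkposreal _ hr); intros x hx hax; simpl in hx.
  unfold ball in hx; simpl in hx; unfold AbsRing_ball, abs, minus, plus, opp in hx.
  simpl in hx; apply Rabs_def2 in hx.
  pose proof (Rmin_l d (eps / (Rabs C + 1))); pose proof (Rmin_r d (eps / (Rabs C + 1))).
  assert (h := hf x ltac:(lra)).
  unfold ball; simpl; unfold AbsRing_ball, abs, minus, plus, opp; simpl.
  apply (Rle_lt_trans _ _ _ h).
  apply (Rle_lt_trans _ ((Rabs C + 1) * (x - a))).
  - pose proof (Rle_abs C); apply Rmult_le_compat_r; lra.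
  - apply (Rlt_le_trans _ ((Rabs C + 1) * (eps / (Rabs C + 1)))).
    + apply Rmult_lt_compat_l; lra.
    + right; field; lra.
Qed.

Lemma filterlim_at_left_linear (f : R -> R) (a d l C : R) :
  0 < d -> (forall x, a - d < x < a -> Rabs (f x - l) <= C * (a - x)) ->
  filterlim f (at_left a) (locally l).
Proof.
  intros hd hf; apply filterlim_locally; intros eps.
  pose proof (cond_pos eps) as he; pose proof (Rabs_pos C) as hC.
  assert (hr : 0 < Rmin d (eps / (Rabs C + 1))).
  { apply Rmin_glb_lt; [lra|apply Rdiv_lt_0_compat; lra]. }
  exists (mkposreal _ hr); intros x hx hax; simpl in hx.
  unfold ball in hx; simpl in hx; unfold AbsRing_ball, abs, minus, plus, opp in hx.
  simpl in hx; apply Rabs_def2 in hx.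
  pose proof (Rmin_l d (eps / (Rabs C + 1))); pose proof (Rmin_r d (eps / (Rabs C + 1))).
  assert (h := hf x ltac:(lra)).
  unfold ball; simpl; unfold AbsRing_ball, abs, minus, plus, opp; simpl.
  apply (Rle_lt_trans _ _ _ h).
  apply (Rle_lt_trans _ ((Rabs C + 1) * (a - x))).
  - pose proof (Rle_abs C); apply Rmult_le_compat_r; lra.
  - apply (Rlt_le_trans _ ((Rabs C + 1) * (eps / (Rabs C + 1)))).
    + apply Rmult_lt_compat_l; lra.
    + right; field; lra.
Qed.

Lemma filterlim_p_infty_inverse (f : R -> R) (a l C : R) :
  (forall x, a < x -> Rabs (f x - l) * (x - a) <= C) ->
  filterlim f (Rbar_locally p_infty) (locally l).
Proof.
  intros hf; apply filterlim_locally; intros eps.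
  pose proof (cond_pos eps) as he; pose proof (Rabs_pos C) as hC.
  exists (a + (Rabs C + 1) / eps); intros x hx.
  assert (0 < (Rabs C + 1) / eps) by (apply Rdiv_lt_0_compat; lra).
  assert (h := hf x ltac:(lra)).
  unfold ball; simpl; unfold AbsRing_ball, abs, minus, plus, opp; simpl.
  fold (Rminus (f x) l).
  apply (Rmult_lt_reg_r (x - a)); [lra|].
  apply (Rle_lt_trans _ _ _ h); pose proof (Rle_abs C).
  apply (Rlt_le_trans _ (Rabs C + 1)); [lra|].
  apply (Rle_trans _ (eps * ((Rabs C + 1) / eps))); [right; field; lra|].
  apply Rmult_le_compat_l; lra.
Qed.

(** * The reduced algebraic system and bounds on the two ratios *)

(* Common form of (S1) and (S2), divided by sigma K: w and 1 - 4 D / 3 are minus the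
   mean of zeta / B and the mean of its square over the eps = 0 orbit. *)
Lemma reduced_system (beta sigma lambda b w A D S : R) :
  0 < beta -> sigma = lambda * (beta + 2) - 1 -> 0 < b ->
  0 <= D -> 4 * D <= 3 ->
  D = w * A + 2 * S -> 3 - 4 * D = 3 * w ^ 2 + 8 * w * A + 4 * S ->
  beta * (1 - b * w) = 4 * sigma * b * A ->
  b * (4 * D + beta * (3 - 4 * D)) = 3 * beta * w ->
  0 < w /\ S = 3 * (lambda - 2 / 3) * w * A /\ b <= (beta + 1) * w.
Proof.
  intros hbeta hs hb hD0 hD1 hD hD' e1 e2.
  set (Q := 4 * D + beta * (3 - 4 * D)) in *.
  (* The difference of the two sides is [4 * D + beta ^ 2 * (3 - 4 * D)]. Since
     [b * Q = 3 * beta * w], this is what bounds [b] by [(beta + 1) * w]. *)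
  assert (hQ : 3 * beta <= Q * (beta + 1)).
  { unfold Q; assert (0 <= beta * (3 - 4 * D)) by (apply Rmult_le_pos; lra); nra. }
  assert (hQ0 : 0 < Q) by nra.
  assert (hw : 0 < w).
  { assert (0 < b * Q) by (apply Rmult_lt_0_compat; lra); nra. }
  split; [exact hw|split].
  (* Multiplying the first equation by [Q] lets the second one eliminate [b]. *)
  - assert (h : beta * Q - beta * (b * Q) * w = 4 * sigma * (b * Q) * A).
    { transitivity (beta * (1 - b * w) * Q); [ring|rewrite e1; ring]. }
    rewrite e2 in h.
    assert (h2 : Q - 3 * beta * w ^ 2 = 12 * sigma * w * A).
    { apply (Rmult_eq_reg_l beta); [|lra]; transitivity (beta * Q - beta * (3 * beta * w) * w);
        [ring|rewrite h; ring]. }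
    unfold Q in h2; rewrite hD' in h2.
    (* The value 2/3 arises here: the coefficient of [w * A] is [12 * sigma - 4 - 8 * beta], which
       is [12 * (beta + 2) * (lambda - 2 / 3)]. *)
    apply (Rmult_eq_reg_l (4 * (beta + 2))); [|lra].
    rewrite hs in h2; rewrite hD in h2; lra.
  - apply (Rmult_le_reg_r Q); [exact hQ0|].
    rewrite e2; apply (Rle_trans _ (Q * (beta + 1) * w)); [|lra].
    apply Rmult_le_compat_r; lra.
Qed.

(** With r = b w and b <= (beta + 1) w, the second bound gives decay as lambda grows. The third
    rests on beta (1 - r) = 4 sigma b A, so it only needs A to be small near lambda = 2/3. *)
Lemma S1_ratio_bounds (beta lambda k B : R) (hbeta : 0 < beta) :
  2 / 3 < lambda -> S1 beta (sigma_of beta lambda) (k, B) ->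
  let r := ratio1 (sigma_of beta lambda) k B in
  0 <= r <= 1 /\
  r * (lambda - 2 / 3) <= 5 * (beta + 1) / 3 /\
  beta * (1 - r) <= 12 * sigma_of beta lambda * (beta + 1) * (lambda - 2 / 3).
Proof.
  intros hl [hk [hB [e1 e2]]] r.
  set (sigma := sigma_of beta lambda) in *.
  assert (hsig : 0 < sigma) by (unfold sigma, sigma_of; nra).
  destruct (ellE_ellK_ratio_bounds k hk) as [hm [_ [_ [hme [hem [hkm _]]]]]].
  assert (hK : 0 < ellK k) by (pose proof (ellK_ge k hk); pose proof PI_RGT_0; lra).
  set (m := 1 - k ^ 2) in *.
  assert (hkk : k ^ 2 = 1 - m) by (unfold m; ring).
  set (e := ellE k / ellK k) in *.
  assert (hE : ellE k = e * ellK k) by (unfold e; field; lra).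
  rewrite hE in e1, e2; rewrite hkk in e2, hkm.
  set (b := B / sigma).
  assert (hBb : B = b * sigma) by (unfold b; field; lra).
  assert (hb : 0 < b) by (apply Rdiv_lt_0_compat; lra).
  assert (hr : r = b * (1 - 2 * e)).
  { unfold r, ratio1; fold b; rewrite hE; field; lra. }
  rewrite hBb in e1, e2; clearbody e b; set (K := ellK k) in *; clearbody K.
  clear hE hBb hB; clearbody m; clear hkk hk.
  assert (e1' : beta * (1 - b * (1 - 2 * e)) = 4 * sigma * b * (e - m)).
  { apply (Rmult_eq_reg_l (K * sigma)); [|nra]; lra. }
  set (D := m + (1 - 2 * m) * e).
  assert (e2' : b * (4 * D + beta * (3 - 4 * D)) = 3 * beta * (1 - 2 * e)).
  { apply (Rmult_eq_reg_l (K * sigma)); [|nra]; unfold D; lra. }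
  assert (hD0 : 0 <= D) by (unfold D; nra).
  assert (hD1 : 4 * D <= 3).
  { unfold D; destruct (Rle_or_lt m (1 / 2)); nra. }
  (* S = e^2 - 2 e m + m, written as a sum of two nonnegative terms. *)
  destruct (reduced_system beta sigma lambda b (1 - 2 * e) (e - m) D
    ((e - m) ^ 2 + (1 - m) * m)) as [hw [hS hbw]]; try assumption.
  { reflexivity. }
  { unfold D; ring. }
  { unfold D; ring. }
  set (w := 1 - 2 * e) in *; set (A := e - m) in *.
  set (x := lambda - 2 / 3) in *.
  assert (hA : 0 < A) by (unfold A; lra).
  assert (hx : 0 < x) by (unfold x; lra).
  assert (hA1 : A <= 1) by (unfold A; lra).
  assert (hw1 : w <= 1) by (unfold w; lra).
  assert (hbA : 0 < sigma * b * A) by (repeat (apply Rmult_lt_0_compat; try assumption)).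
  assert (hbw1 : 0 < b * w) by (apply Rmult_lt_0_compat; lra).
  assert (hbw2 : 0 < 1 - b * w) by (apply (Rmult_lt_reg_l beta); lra).
  rewrite hr; split; [lra|split].
  (* Positivity of [w] forces m < e < 1/2, so (1 - m) m <= 2 A gives m <= 4 A. Then S <= A + 4 A,
     which is the source of the 5. *)
  - assert (hm2 : m < 1 / 2) by (unfold w in hw; lra).
    assert (hmA : m <= 4 * A) by nra.
    assert (hxw : 3 * (x * w) <= 5).
    { apply (Rmult_le_reg_r A); [exact hA|].
      apply (Rle_trans _ (A ^ 2 + (1 - m) * m)); [rewrite hS; right; ring|nra]. }
    apply (Rle_trans _ ((beta + 1) * (w * (x * w)))).
    + assert (0 < w * x) by nra.
      apply (Rle_trans _ ((beta + 1) * w * (w * x))); [|right; ring].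
      rewrite Rmult_assoc; apply Rmult_le_compat_r; lra.
    + assert (0 < x * w) by nra.
      assert (w * (x * w) <= 1 * (x * w)) by (apply Rmult_le_compat_r; lra).
      assert ((beta + 1) * (w * (x * w)) <= (beta + 1) * (5 / 3))
        by (apply Rmult_le_compat_l; lra).
      lra.
  - rewrite e1'.
    (* From A^2 <= S = 3 x w A and w <= 1. *)
    assert (hAx : A <= 3 * x).
    { apply (Rmult_le_reg_r A); [exact hA|].
      assert (0 <= (1 - m) * m) by nra.
      assert (3 * x * w * A <= 3 * x * A).
      { assert (0 < x * A) by nra; nra. }
      nra. }
    assert (hb1 : b <= beta + 1) by nra.
    assert (b * A <= (beta + 1) * (3 * x)) by (apply Rmult_le_compat; lra).
    assert (sigma * (b * A) <= sigma * ((beta + 1) * (3 * x)))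
      by (apply Rmult_le_compat_l; lra).
    lra.
Qed.

(** Again r = b w and beta (1 - r) = 4 sigma b A. Near lambda = 1 the variance bound makes 1 - m,
    hence w, small; near lambda = 2/3 the excess of e over c = sqrt m makes e small. *)
Lemma S2_ratio_bounds (beta lambda k B : R) (hbeta : 0 < beta) :
  2 / 3 < lambda < 1 -> S2 beta (sigma_of beta lambda) (k, B) ->
  let r := ratio2 (sigma_of beta lambda) k B in
  0 <= r <= 1 /\
  r <= 8193 * (beta + 1) * (1 - lambda) /\
  beta * (1 - r) <= 72 * sigma_of beta lambda * (beta + 1) * (lambda - 2 / 3).
Proof.
  intros hl [hk [hB [e1 e2]]] r.
  set (sigma := sigma_of beta lambda) in *.
  assert (hsig : 0 < sigma) by (unfold sigma, sigma_of; nra).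
  destruct (ellE_ellK_ratio_bounds k hk)
    as [hm [hc [hcm [hme [hem [_ [hce [hc6 hvar]]]]]]]].
  assert (hK : 0 < ellK k) by (pose proof (ellK_ge k hk); pose proof PI_RGT_0; lra).
  set (m := 1 - k ^ 2) in *; set (c := sqrt m) in *.
  assert (hkk : k ^ 2 = 1 - m) by (unfold m; ring).
  assert (hk4 : k ^ 4 = (1 - m) ^ 2) by (unfold m; ring).
  assert (hk8 : k ^ 8 = (1 - m) ^ 4) by (unfold m; ring).
  set (e := ellE k / ellK k) in *.
  assert (hE : ellE k = e * ellK k) by (unfold e; field; lra).
  rewrite hE, hkk in e1, e2; rewrite hk4 in e2; rewrite hk8 in hvar.
  set (b := B / sigma).
  assert (hBb : B = b * sigma) by (unfold b; field; lra).
  assert (hb : 0 < b) by (apply Rdiv_lt_0_compat; lra).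
  assert (hr : r = b * ((1 + m - 2 * e) / (1 - m))).
  { unfold r, ratio2; fold b; rewrite hE, hkk; field; lra. }
  rewrite hBb in e1, e2; clearbody e b; set (K := ellK k) in *; clearbody K.
  clear hE hBb hB; clearbody c; clearbody m; clear hkk hk4 hk8 hk.
  set (w := (1 + m - 2 * e) / (1 - m)) in *; set (A := e / (1 - m)).
  set (D := ((1 + m) * e - 2 * m) / (1 - m) ^ 2).
  set (S := (e ^ 2 - m) / (1 - m) ^ 2).
  assert (hn2 : 0 < (1 - m) ^ 2) by (apply pow_lt; lra).
  assert (e1' : beta * (1 - b * w) = 4 * sigma * b * A).
  { apply (Rmult_eq_reg_l (K * sigma)); [|nra].
    apply Rminus_diag_uniq; rewrite <- e1; unfold w, A; field; lra. }
  assert (e2' : b * (4 * D + beta * (3 - 4 * D)) = 3 * beta * w).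
  { apply (Rmult_eq_reg_l (K * sigma * (1 - m) ^ 2));
      [|repeat apply Rmult_integral_contrapositive_currified; lra].
    apply Rminus_diag_uniq; rewrite <- e2; unfold w, D; field; lra. }
  assert (hw0 : 0 <= w) by (apply Rdiv_le_0_compat; lra).
  assert (hA : 0 < A) by (apply Rdiv_lt_0_compat; lra).
  assert (hS0 : 0 < S) by (apply Rdiv_lt_0_compat; nra).
  assert (hD : D = w * A + 2 * S) by (unfold D, w, A, S; field; lra).
  assert (hD' : 3 - 4 * D = 3 * w ^ 2 + 8 * w * A + 4 * S)
    by (unfold D, w, A, S; field; lra).
  assert (hwA : 0 <= w * A) by (apply Rmult_le_pos; lra).
  destruct (reduced_system beta sigma lambda b w A D S) as [hw [hS hbw]];
    try assumption; try lra.
  { reflexivity. }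
  { assert (0 <= w ^ 2) by apply pow2_ge_0; lra. }
  set (x := lambda - 2 / 3) in *.
  assert (hx : 0 < x) by (unfold x; lra).
  assert (hS' : e ^ 2 - m = 3 * x * ((1 + m - 2 * e) * e)).
  { apply (Rmult_eq_reg_l (/ (1 - m) ^ 2)); [|apply Rinv_neq_0_compat; lra].
    transitivity S; [unfold S; field; lra|]; rewrite hS; unfold w, A; field; lra. }
  assert (hy0 : 0 < 1 + m - 2 * e).
  { replace (1 + m - 2 * e) with (w * (1 - m)) by (unfold w; field; lra); nra. }
  (* Since e > c and m = c^2, the left side is below 1 + c^2 - 2 c. *)
  assert (hy : 1 + m - 2 * e <= (1 - c) ^ 2) by nra.
  assert (hn : 1 - m = (1 - c) * (1 + c)) by nra.
  assert (hcn : 1 - c <= 1 - m) by nra.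
  assert (hwc : w * (1 - m) <= (1 - c) ^ 2).
  { replace (w * (1 - m)) with (1 + m - 2 * e) by (unfold w; field; lra); exact hy. }
  assert (hcn2 : (1 - c) ^ 2 <= (1 - m) ^ 2) by (apply pow_incr; lra).
  assert (hwn : w <= 1 - m) by (apply (Rmult_le_reg_r (1 - m)); lra).
  assert (hbA : 0 < sigma * b * A) by (repeat (apply Rmult_lt_0_compat; try assumption)).
  assert (hbw1 : 0 < b * w) by (apply Rmult_lt_0_compat; lra).
  assert (hbw2 : 0 < 1 - b * w) by (apply (Rmult_lt_reg_l beta); lra).
  rewrite hr; split; [lra|split].
  (* The variance expression is e (1 + m - 2 e) - (e^2 - m), and [hS'] turns the last term into 3
     (lambda - 2/3) times the first; the factor 1 - lambda comes from 1 - 3 (lambda - 2/3) = 3 (1 -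
     lambda). Then 8193 = 3 * 2731. *)
  - assert (hv : (1 + m) * e + m - 3 * e ^ 2 = 3 * (1 - lambda) * ((1 + m - 2 * e) * e)).
    { unfold x in hS'; lra. }
    rewrite hv in hvar.
    assert (he : 0 < e) by lra.
    assert (hv1 : (1 - m) ^ 4 <= 8193 * (1 - lambda) * (1 + m - 2 * e)).
    { apply (Rmult_le_reg_r e); [exact he|]; lra. }
    assert (hyn : 1 + m - 2 * e <= (1 - m) ^ 2) by lra.
    assert (hv2 : (1 - m) ^ 2 <= 8193 * (1 - lambda)).
    { apply (Rmult_le_reg_r ((1 - m) ^ 2)); [exact hn2|].
      apply (Rle_trans _ ((1 - m) ^ 4)); [right; ring|].
      apply (Rle_trans _ _ _ hv1); apply Rmult_le_compat_l; lra. }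
    assert (hw2 : w ^ 2 <= (1 - m) ^ 2) by (apply pow_incr; lra).
    apply (Rle_trans _ ((beta + 1) * w ^ 2)).
    + replace ((beta + 1) * w ^ 2) with ((beta + 1) * w * w) by ring.
      apply Rmult_le_compat_r; lra.
    + apply (Rle_trans _ ((beta + 1) * (8193 * (1 - lambda)))); [|lra].
      apply Rmult_le_compat_l; lra.
  - rewrite e1'.
    assert (he : 0 < e) by lra.
    (* Factor e^2 - m as (e - c) (e + c), and bound the right side of [hS'] by [hy] and e <= e +
       c. *)
    assert (hec : e - c <= 3 * x * (1 - c) ^ 2).
    { apply (Rmult_le_reg_r (e + c)); [lra|].
      replace ((e - c) * (e + c)) with (e ^ 2 - m) by (rewrite <- hcm; ring).
      rewrite hS', Rmult_assoc; rewrite (Rmult_assoc (3 * x)).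
      rewrite <- (Rmult_assoc 3); apply Rmult_le_compat_l; [lra|].
      apply Rmult_le_compat; lra. }
    (* Combined with (1 - c)^2 e <= 6 (e - c), the factor (1 - c)^2 cancels, leaving a bound uniform
       in the modulus. *)
    assert (he18 : e <= 18 * x).
    { apply (Rmult_le_reg_l ((1 - c) ^ 2)); [apply pow_lt; lra|]; lra. }
    assert (hwA1 : w * A <= e).
    { apply (Rmult_le_reg_r ((1 - m) ^ 2)); [exact hn2|].
      replace (w * A * (1 - m) ^ 2) with ((w * (1 - m)) * e) by (unfold A; field; lra).
      rewrite (Rmult_comm e); apply Rmult_le_compat_r; [lra|].
      apply (Rle_trans _ _ _ hwc); nra. }
    assert (hbA1 : b * A <= (beta + 1) * (18 * x)).
    { apply (Rle_trans _ ((beta + 1) * w * A)); [apply Rmult_le_compat_r; lra|].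
      rewrite Rmult_assoc; apply Rmult_le_compat_l; lra. }
    assert (sigma * (b * A) <= sigma * ((beta + 1) * (18 * x)))
      by (apply Rmult_le_compat_l; lra).
    lra.
Qed.

Lemma sigma_of_bound (beta lambda : R) :
  0 < beta -> 2 / 3 < lambda < 1 -> 0 < sigma_of beta lambda <= beta + 1.
Proof. unfold sigma_of; intros; split; nra. Qed.

Lemma ratio1_limits (beta : R) (k B : R -> R) (hbeta : 0 < beta) :
  (forall lambda, 2 / 3 < lambda ->
     S1 beta (sigma_of beta lambda) (k lambda, B lambda)) ->
  let r := fun lambda => ratio1 (sigma_of beta lambda) (k lambda) (B lambda) in
  filterlim r (at_right (2 / 3)) (locally 1) /\
  filterlim r (Rbar_locally p_infty) (locally 0).
Proof.
  intros h r; split.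
  - apply (filterlim_at_right_linear r _ (1 / 3) _ (12 * (beta + 1) ^ 2 / beta)); [lra|].
    intros x hx; destruct (S1_ratio_bounds beta x _ _ hbeta ltac:(lra) (h x ltac:(lra)))
      as [h0 [_ h1]].
    fold (r x) in h0, h1; pose proof (sigma_of_bound beta x hbeta ltac:(lra)) as hs.
    rewrite Rabs_left1 by lra.
    apply (Rmult_le_reg_l beta); [exact hbeta|].
    replace (beta * (12 * (beta + 1) ^ 2 / beta * (x - 2 / 3)))
      with (12 * (beta + 1) * (beta + 1) * (x - 2 / 3)) by (field; lra).
    apply (Rle_trans _ (beta * (1 - r x))); [lra|].
    apply (Rle_trans _ _ _ h1), Rmult_le_compat_r; [lra|].
    apply Rmult_le_compat_r; lra.
  - apply (filterlim_p_infty_inverse r (2 / 3) 0 (5 * (beta + 1) / 3)).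
    intros x hx; destruct (S1_ratio_bounds beta x _ _ hbeta hx (h x hx)) as [h0 [h1 _]].
    fold (r x) in h0, h1; rewrite Rminus_0_r, Rabs_pos_eq by lra; exact h1.
Qed.

Lemma ratio2_limits (beta : R) (k B : R -> R) (hbeta : 0 < beta) :
  (forall lambda, 2 / 3 < lambda < 1 ->
     S2 beta (sigma_of beta lambda) (k lambda, B lambda)) ->
  let r := fun lambda => ratio2 (sigma_of beta lambda) (k lambda) (B lambda) in
  filterlim r (at_right (2 / 3)) (locally 1) /\
  filterlim r (at_left 1) (locally 0).
Proof.
  intros h r; split.
  - apply (filterlim_at_right_linear r _ (1 / 3) _ (72 * (beta + 1) ^ 2 / beta)); [lra|].
    intros x hx; destruct (S2_ratio_bounds beta x _ _ hbeta ltac:(lra) (h x ltac:(lra)))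
      as [h0 [_ h1]].
    fold (r x) in h0, h1; pose proof (sigma_of_bound beta x hbeta ltac:(lra)) as hs.
    rewrite Rabs_left1 by lra.
    apply (Rmult_le_reg_l beta); [exact hbeta|].
    replace (beta * (72 * (beta + 1) ^ 2 / beta * (x - 2 / 3)))
      with (72 * (beta + 1) * (beta + 1) * (x - 2 / 3)) by (field; lra).
    apply (Rle_trans _ (beta * (1 - r x))); [lra|].
    apply (Rle_trans _ _ _ h1), Rmult_le_compat_r; [lra|].
    apply Rmult_le_compat_r; lra.
  - apply (filterlim_at_left_linear r _ (1 / 3) _ (8193 * (beta + 1))); [lra|].
    intros x hx; destruct (S2_ratio_bounds beta x _ _ hbeta ltac:(lra) (h x ltac:(lra)))
      as [h0 [h1 _]].
    fold (r x) in h0, h1; rewrite Rminus_0_r, Rabs_pos_eq by lra; exact h1.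
Qed.

(** * Comparison of solutions of the rescaled equations by Gronwall's inequality *)

Lemma is_derive_fst {U V : NormedModule R_AbsRing} (g : R -> U * V) (t : R) (l : U * V) :
  is_derive g t l -> is_derive (fun s => fst (g s)) t (fst l).
Proof.
  intros h; unfold is_derive in *.
  apply (filterdiff_ext_lin _ (fun y : R => fst (scal y l : U * V))); [|reflexivity].
  apply (filterdiff_comp' g fst t (fun y : R => scal y l) fst); [exact h|].
  apply filterdiff_linear, is_linear_fst.
Qed.

Lemma is_derive_snd {U V : NormedModule R_AbsRing} (g : R -> U * V) (t : R) (l : U * V) :
  is_derive g t l -> is_derive (fun s => snd (g s)) t (snd l).
Proof.
  intros h; unfold is_derive in *.
  apply (filterdiff_ext_lin _ (fun y : R => snd (scal y l : U * V))); [|reflexivity].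
  apply (filterdiff_comp' g snd t (fun y : R => scal y l) snd); [exact h|].
  apply filterdiff_linear, is_linear_snd.
Qed.

Lemma norm_vec3_bounds (p : vec3) :
  Rabs (fst (fst p)) <= norm p /\ Rabs (snd (fst p)) <= norm p /\ Rabs (snd p) <= norm p.
Proof.
  destruct p as [[x y] z]; cbn [fst snd].
  destruct (@norm_prod R_AbsRing (prod_NormedModule R_AbsRing R_NormedModule R_NormedModule)
    R_NormedModule (x, y) z) as [h _].
  destruct (@norm_prod R_AbsRing R_NormedModule R_NormedModule x y) as [h' _].
  change (@norm R_AbsRing R_NormedModule x) with (Rabs x) in *.
  change (@norm R_AbsRing R_NormedModule y) with (Rabs y) in *.
  change (@norm R_AbsRing R_NormedModule z) with (Rabs z) in *.
  pose proof (Rle_trans _ _ _ (Rmax_l _ _) h) as h1.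
  pose proof (Rle_trans _ _ _ (Rmax_r _ _) h) as h2.
  pose proof (Rle_trans _ _ _ (Rmax_l _ _) h') as h3.
  pose proof (Rle_trans _ _ _ (Rmax_r _ _) h') as h4.
  repeat split; [exact (Rle_trans _ _ _ h3 h1)|exact (Rle_trans _ _ _ h4 h1)|exact h2].
Qed.

Lemma mean_value_le (f df : R -> R) (a b : R) : a <= b ->
  (forall t, a <= t <= b -> is_derive f t (df t)) ->
  (forall t, a <= t <= b -> df t <= 0) -> f b <= f a.
Proof.
  intros hab hd hneg.
  destruct (MVT_gen f a b df) as [c [hc hf]]; rewrite ?Rmin_left, ?Rmax_right in * by lra.
  - intros x hx; apply hd; lra.
  - intros x hx; apply continuity_pt_filterlim.
    apply (ex_derive_continuous f); eexists; apply hd; lra.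
  - pose proof (hneg c hc); nra.
Qed.

Lemma mean_value_abs_le (f df : R -> R) (a b q : R) : a <= b ->
  (forall t, a <= t <= b -> is_derive f t (df t)) ->
  (forall t, a <= t <= b -> Rabs (df t) <= q) -> Rabs (f b - f a) <= (b - a) * q.
Proof.
  intros hab hd hq.
  destruct (MVT_gen f a b df) as [c [hc hf]]; rewrite ?Rmin_left, ?Rmax_right in * by lra.
  - intros x hx; apply hd; lra.
  - intros x hx; apply continuity_pt_filterlim.
    apply (ex_derive_continuous f); eexists; apply hd; lra.
  - rewrite hf, Rabs_mult, (Rabs_pos_eq (b - a)), Rmult_comm by lra.
    apply Rmult_le_compat_l; [lra|apply hq, hc].
Qed.

Ltac rewrite_Derive h :=
  match goal with |- context [Derive ?f ?x] => rewrite (is_derive_unique f x _ h) end.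

(** The product of [V + c / L] with the decaying exponential is nonincreasing. It is applied to a
    squared distance, which is differentiable everywhere. *)
Lemma gronwall (V dV : R -> R) (L c a t : R) :
  0 < L -> (forall s, is_derive V s (dV s)) -> (forall s, dV s <= L * V s + c) ->
  a <= t -> V t + c / L <= (V a + c / L) * exp (L * (t - a)).
Proof.
  intros hL hd hV hat.
  pose (W := fun s => (V s + c / L) * exp (- (L * (s - a)))).
  assert (hW : W t <= W a).
  { apply (mean_value_le W
      (fun s => (dV s - L * V s - c) * exp (- (L * (s - a))))); [exact hat| |].
    - intros s _; unfold W; auto_derive; [repeat split; eexists; apply hd|].
      rewrite_Derive (hd s); replace (s + - a) with (s - a) by ring.
      field; lra.
    - intros s _; pose proof (exp_pos (- (L * (s - a)))); pose proof (hV s).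
      nra. }
  unfold W in hW; replace (- (L * (a - a))) with 0 in hW by ring.
  rewrite exp_0, Rmult_1_r in hW.
  rewrite exp_Ropp in hW; pose proof (exp_pos (L * (t - a))) as he.
  apply (Rmult_le_compat_r (exp (L * (t - a)))) in hW; [|lra].
  rewrite Rmult_assoc, Rinv_l, Rmult_1_r in hW by lra; exact hW.
Qed.

(** System (R) in scalar form, so that real calculus applies to each coordinate; [eps = 0] is the
    limit system solved by the elliptic orbits. *)
Definition solves_componentwise (sigma beta eps : R) (g : R -> vec3) : Prop :=
  (forall t, is_derive (fun s => fst (fst (g s))) t
               (snd (fst (g t)) - eps * sigma * fst (fst (g t)))) /\
  (forall t, is_derive (fun s => snd (fst (g s))) t
               (- fst (fst (g t)) * snd (g t) - eps * snd (fst (g t)))) /\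
  (forall t, is_derive (fun s => snd (g s)) t
               (fst (fst (g t)) * snd (fst (g t)) - eps * beta * (snd (g t) + sigma))).

Lemma is_solution_componentwise (sigma beta eps : R) (g : R -> vec3) :
  is_solution (rescaled_lorenz sigma beta eps) g -> solves_componentwise sigma beta eps g.
Proof.
  intros h; split; [|split]; intros t; specialize (h t);
    destruct (g t) as [[x y] z] eqn:hg; simpl in h |- *.
  - apply is_derive_fst in h; apply is_derive_fst in h; exact h.
  - apply is_derive_fst in h; apply is_derive_snd in h; exact h.
  - apply is_derive_snd in h; exact h.
Qed.

Lemma is_derive_sum_sqr (p q r : R -> R) (s p' q' r' : R) :
  is_derive p s p' -> is_derive q s q' -> is_derive r s r' ->
  is_derive (fun t => p t ^ 2 + q t ^ 2 + r t ^ 2) s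
    (2 * p s * p' + 2 * q s * q' + 2 * r s * r').
Proof.
  intros hp hq hr; auto_derive.
  - repeat split; eexists; eassumption.
  - repeat first [rewrite_Derive hp | rewrite_Derive hq | rewrite_Derive hr]; ring.
Qed.

(** The squared distance V of the two solutions starts below 3 C^2 eps^2 and satisfies V' <= (2 M +
    2) V + eps^2 N, so it stays of order eps^2 over a fixed time T. *)
Lemma perturbation_estimate (sigma beta eps M C T : R) (g h : R -> vec3) :
  0 <= eps -> 0 <= M -> 0 <= C ->
  solves_componentwise sigma beta eps g -> solves_componentwise sigma beta 0 h ->
  (forall t, Rabs (fst (fst (g t))) <= M /\ Rabs (snd (fst (g t))) <= M /\
             Rabs (snd (g t)) <= M) ->
  Rabs (fst (fst (g 0)) - fst (fst (h 0))) <= C * eps ->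
  Rabs (snd (fst (g 0)) - snd (fst (h 0))) <= C * eps ->
  Rabs (snd (g 0) - snd (h 0)) <= C * eps ->
  let N := sigma ^ 2 * M ^ 2 + M ^ 2 + beta ^ 2 * (M + Rabs sigma) ^ 2 in
  forall t, 0 <= t <= T ->
  Rabs (snd (g t) - snd (h t)) <=
  eps * ((3 * C ^ 2 + N) * exp ((2 * M + 2) * T) + 1).
Proof.
  intros heps hM hC [g1 [g2 g3]] [h1 [h2 h3]] hb d1 d2 d3 N t ht.
  pose (p := fun t => fst (fst (g t)) - fst (fst (h t))).
  pose (q := fun t => snd (fst (g t)) - snd (fst (h t))).
  pose (r := fun t => snd (g t) - snd (h t)).
  pose (x := fun t => fst (fst (g t))); pose (y := fun t => snd (fst (g t))).
  pose (z := fun t => snd (g t)).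
  pose (V := fun t => p t ^ 2 + q t ^ 2 + r t ^ 2).
  (* The quadratic terms of (R) produce two opposite contributions in [q * r]; after they cancel,
     all coefficients are components of [g], which are bounded by [M]. *)
  pose (dV := fun t => 2 * p t * q t * (1 - z t) + 2 * r t * p t * y t
    - 2 * eps * (sigma * p t * x t + q t * y t + beta * r t * (z t + sigma))).
  assert (hd : forall s, is_derive V s (dV s)).
  { intros s.
    pose proof (is_derive_minus _ _ _ _ _ (g1 s) (h1 s)) as hp.
    pose proof (is_derive_minus _ _ _ _ _ (g2 s) (h2 s)) as hq.
    pose proof (is_derive_minus _ _ _ _ _ (g3 s) (h3 s)) as hr.
    replace (dV s) with (2 * p s * (snd (fst (g s)) - eps * sigma * fst (fst (g s))
        - (snd (fst (h s)) - 0 * sigma * fst (fst (h s))))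
      + 2 * q s * (- fst (fst (g s)) * snd (g s) - eps * snd (fst (g s))
        - (- fst (fst (h s)) * snd (h s) - 0 * snd (fst (h s))))
      + 2 * r s * (fst (fst (g s)) * snd (fst (g s)) - eps * beta * (snd (g s) + sigma)
        - (fst (fst (h s)) * snd (fst (h s)) - 0 * beta * (snd (h s) + sigma))))
      by (unfold dV, p, q, r, x, y, z; ring).
    exact (is_derive_sum_sqr p q r s _ _ _ hp hq hr). }
  assert (hN : 0 <= N).
  { pose proof (pow2_ge_0 (sigma * M)); pose proof (pow2_ge_0 M).
    pose proof (pow2_ge_0 (beta * (M + Rabs sigma))).
    unfold N; rewrite <- !Rpow_mult_distr; lra. }
  (* Each eps-term is split by 2ab <= a^2 + b^2 into one square of p, q or r and a part of eps^2 N.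
     The largest coefficient is that of p^2: (1 + M) + M + 1. *)
  assert (hV : forall s, dV s <= (2 * M + 2) * V s + eps ^ 2 * N).
  { intros s; destruct (hb s) as [bx [by_ bz]]; fold (x s) (y s) (z s) in bx, by_, bz.
    assert (cauchy : forall a b K, Rabs b <= K -> 2 * a * b <= a ^ 2 + K ^ 2).
    { intros a b K hK; assert (b ^ 2 <= K ^ 2).
      { rewrite <- (pow2_abs b); apply pow_incr; split; [apply Rabs_pos|exact hK]. }
      assert (0 <= (a - b) ^ 2) by apply pow2_ge_0; nra. }
    assert (bz' : Rabs (z s + sigma) <= M + Rabs sigma).
    { apply (Rle_trans _ _ _ (Rabs_triang _ _)); lra. }
    assert (c1 : - 2 * eps * (sigma * p s * x s) <= p s ^ 2 + eps ^ 2 * (sigma ^ 2 * M ^ 2)).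
    { replace (- 2 * eps * (sigma * p s * x s)) with (2 * p s * (- (eps * sigma * x s))) by ring.
      replace (eps ^ 2 * (sigma ^ 2 * M ^ 2)) with ((eps * Rabs sigma * M) ^ 2)
        by (rewrite !Rpow_mult_distr, pow2_abs; ring).
      apply cauchy; rewrite Rabs_Ropp, !Rabs_mult, (Rabs_pos_eq eps) by lra.
      apply Rmult_le_compat_l; [|exact bx]; apply Rmult_le_pos; [lra|apply Rabs_pos]. }
    assert (c2 : - 2 * eps * (q s * y s) <= q s ^ 2 + eps ^ 2 * M ^ 2).
    { replace (- 2 * eps * (q s * y s)) with (2 * q s * (- (eps * y s))) by ring.
      rewrite <- Rpow_mult_distr; apply cauchy.
      rewrite Rabs_Ropp, !Rabs_mult, (Rabs_pos_eq eps) by lra.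
      apply Rmult_le_compat_l; lra. }
    assert (c3 : - 2 * eps * (beta * r s * (z s + sigma)) <=
      r s ^ 2 + eps ^ 2 * (beta ^ 2 * (M + Rabs sigma) ^ 2)).
    { replace (- 2 * eps * (beta * r s * (z s + sigma)))
        with (2 * r s * (- (eps * beta * (z s + sigma)))) by ring.
      replace (eps ^ 2 * (beta ^ 2 * (M + Rabs sigma) ^ 2))
        with ((eps * Rabs beta * (M + Rabs sigma)) ^ 2)
        by (rewrite !Rpow_mult_distr, pow2_abs; ring).
      apply cauchy; rewrite Rabs_Ropp, !Rabs_mult, (Rabs_pos_eq eps) by lra.
      apply Rmult_le_compat_l; [|exact bz']; apply Rmult_le_pos; [lra|apply Rabs_pos]. }
    assert (prod : forall a b w K, Rabs w <= K -> 2 * a * b * w <= K * (a ^ 2 + b ^ 2)).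
    { intros a b w K hw; apply Rabs_le_between in hw.
      assert (0 <= (a - b) ^ 2) by apply pow2_ge_0.
      assert (0 <= (a + b) ^ 2) by apply pow2_ge_0.
      nra. }
    assert (c4 : 2 * p s * q s * (1 - z s) <= (1 + M) * (p s ^ 2 + q s ^ 2)).
    { apply prod; apply Rabs_le_between in bz; apply Rabs_le_between; lra. }
    assert (c5 : 2 * r s * p s * y s <= M * (r s ^ 2 + p s ^ 2)) by (apply prod; exact by_).
    unfold dV, V, N.
    assert (0 <= p s ^ 2) by apply pow2_ge_0.
    assert (0 <= q s ^ 2) by apply pow2_ge_0.
    assert (0 <= r s ^ 2) by apply pow2_ge_0.
    nra. }
  assert (hG := gronwall V dV (2 * M + 2) (eps ^ 2 * N) 0 t ltac:(lra) hd hV (proj1 ht)).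
  rewrite Rminus_0_r in hG.
  assert (hV0 : V 0 <= 3 * C ^ 2 * eps ^ 2).
  { assert (sq : forall a, Rabs a <= C * eps -> a ^ 2 <= C ^ 2 * eps ^ 2).
    { intros a ha; rewrite <- pow2_abs, <- Rpow_mult_distr.
      apply pow_incr; split; [apply Rabs_pos|exact ha]. }
    unfold V; pose proof (sq _ d1); pose proof (sq _ d2); pose proof (sq _ d3).
    unfold p, q, r; lra. }
  set (P := (3 * C ^ 2 + N) * exp ((2 * M + 2) * T)).
  assert (he : exp ((2 * M + 2) * t) <= exp ((2 * M + 2) * T)).
  { destruct (Rle_lt_or_eq_dec _ _ (proj2 ht)) as [hlt|heq].
    - left; apply exp_increasing; apply Rmult_lt_compat_l; lra.
    - right; rewrite heq; reflexivity. }
  pose proof (exp_pos ((2 * M + 2) * t)) as he0.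
  assert (hP : 0 <= P).
  { unfold P; apply Rmult_le_pos; [pose proof (pow2_ge_0 C); lra|lra]. }
  assert (hdiv : 0 <= eps ^ 2 * N / (2 * M + 2) <= eps ^ 2 * N).
  { assert (0 <= eps ^ 2 * N) by (apply Rmult_le_pos; [apply pow2_ge_0|exact hN]).
    split; [apply Rdiv_le_0_compat; lra|].
    apply (Rmult_le_reg_r (2 * M + 2)); [lra|].
    replace (eps ^ 2 * N / (2 * M + 2) * (2 * M + 2)) with (eps ^ 2 * N) by (field; lra).
    nra. }
  assert (hr : r t ^ 2 <= eps ^ 2 * P).
  { assert (r t ^ 2 <= V t).
    { unfold V; pose proof (pow2_ge_0 (p t)); pose proof (pow2_ge_0 (q t)); lra. }
    apply (Rle_trans _ ((V 0 + eps ^ 2 * N / (2 * M + 2)) * exp ((2 * M + 2) * t))); [lra|].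
    apply (Rle_trans _ ((3 * C ^ 2 * eps ^ 2 + eps ^ 2 * N) * exp ((2 * M + 2) * T)));
      [|unfold P; right; ring].
    apply Rmult_le_compat; try lra.
    unfold V; pose proof (pow2_ge_0 (p 0)); pose proof (pow2_ge_0 (q 0));
      pose proof (pow2_ge_0 (r 0)); lra. }
  (* Since P <= (P + 1)^2, the factor P + 1 replaces the square root of P. *)
  fold (r t); fold P; rewrite <- (Rabs_pos_eq (eps * (P + 1))).
  2:{ apply Rmult_le_pos; lra. }
  apply Rsqr_le_abs_0; rewrite !Rsqr_pow2, Rpow_mult_distr.
  apply (Rle_trans _ _ _ hr), Rmult_le_compat_l; [apply pow2_ge_0|nra].
Qed.

(** * Long-time averages and upper limits *)

(** Induction on the number of periods: each full one costs T q, and the incomplete one costs at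
    most T (M + |m|), a constant that averaging over t removes. *)
Lemma average_of_periodic_increments (J z : R -> R) (T m M q : R) :
  0 < T -> (forall t, is_derive J t (z t)) -> (forall t, Rabs (z t) <= M) ->
  (forall a, Rabs (J (a + T) - J a - T * m) <= T * q) ->
  forall t, 0 <= t -> Rabs (J t - J 0 - t * m) <= t * q + T * (M + Rabs m).
Proof.
  intros hT hJ hz hq.
  assert (hq0 : 0 <= q).
  { pose proof (Rabs_pos (J (0 + T) - J 0 - T * m)); pose proof (hq 0); nra. }
  assert (hM : 0 <= M) by (pose proof (Rabs_pos (z 0)); pose proof (hz 0); lra).
  pose proof (Rabs_pos m) as hm.
  assert (hn : forall n t, 0 <= t <= INR n * T ->
    Rabs (J t - J 0 - t * m) <= t * q + T * (M + Rabs m)).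
  { induction n as [|n IH]; intros t ht.
    - simpl in ht; replace t with 0 by lra.
      replace (J 0 - J 0 - 0 * m) with 0 by ring; rewrite Rabs_R0.
      assert (0 <= T * (M + Rabs m)) by (apply Rmult_le_pos; lra); lra.
    - destruct (Rle_or_lt t T) as [h|h].
      + pose proof (mean_value_abs_le J z 0 t M (proj1 ht) (fun s _ => hJ s)
          (fun s _ => hz s)) as h1.
        assert (h2 : Rabs (t * m) <= T * Rabs m).
        { rewrite Rabs_mult, Rabs_pos_eq by lra; apply Rmult_le_compat_r; lra. }
        assert ((t - 0) * M <= T * M) by (apply Rmult_le_compat_r; lra).
        assert (0 <= t * q) by (apply Rmult_le_pos; lra).
        pose proof (Rabs_triang (J t - J 0) (- (t * m))) as h3; rewrite Rabs_Ropp in h3.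
        unfold Rminus at 1; lra.
      + rewrite S_INR in ht.
        specialize (IH (t - T) ltac:(lra)); specialize (hq (t - T)).
        replace (t - T + T) with t in hq by ring.
        replace (J t - J 0 - t * m) with
          ((J (t - T) - J 0 - (t - T) * m) + (J t - J (t - T) - T * m)) by ring.
        pose proof (Rabs_triang (J (t - T) - J 0 - (t - T) * m) (J t - J (t - T) - T * m)).
        lra. }
  intros t ht; destruct (nfloor_ex (t / T)) as [n hn'].
  { apply Rdiv_le_0_compat; lra. }
  apply (hn (S n)); rewrite S_INR; split; [exact ht|].
  replace t with (t / T * T) at 1 by (field; lra); apply Rmult_le_compat_r; lra.
Qed.

(** Since K / t dies out, every tail supremum is at least c - d - eta and some tail supremum is at
    most c + d + eta. This also excludes infinite values of the upper limit. *)
Lemma LimSup_p_infty_near (f : R -> R) (c d K : R) :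
  (forall t, 0 < t -> Rabs (f t - c) <= d + K / t) ->
  exists h : R, LimSup_p_infty f = Finite h /\ Rabs (h - c) <= d.
Proof.
  intros hf.
  assert (hev : forall eta, 0 < eta -> exists T, forall t, T <= t ->
    c - d - eta <= f t <= c + d + eta).
  { intros eta heta; pose proof (Rabs_pos K).
    assert (hT : 0 < (Rabs K + 1) / eta) by (apply Rdiv_lt_0_compat; lra).
    exists ((Rabs K + 1) / eta); intros t ht.
    assert (h := hf t ltac:(lra)); apply Rabs_le_between in h.
    assert (K / t <= eta).
    { apply (Rmult_le_reg_r t); [lra|].
      replace (K / t * t) with K by (field; lra).
      apply (Rle_trans _ (Rabs K + 1)); [pose proof (Rle_abs K); lra|].
      replace (Rabs K + 1) with (eta * ((Rabs K + 1) / eta)) by (field; lra).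
      apply Rmult_le_compat_l; lra. }
    lra. }
  set (E := fun s : Rbar => exists T : R,
    s = Lub_Rbar (fun y : R => exists t : R, T <= t /\ y = f t)).
  assert (hlow : forall eta, 0 < eta -> forall s, E s -> Rbar_le (c - d - eta) s).
  { intros eta heta s [T hs]; subst s.
    destruct (hev eta heta) as [T' hT'].
    destruct (Lub_Rbar_correct (fun y : R => exists t : R, T <= t /\ y = f t)) as [hub _].
    apply (Rbar_le_trans _ (f (Rmax T T'))).
    - apply hT', Rmax_r.
    - apply hub; exists (Rmax T T'); split; [apply Rmax_l|reflexivity]. }
  assert (hup : forall eta, 0 < eta -> exists s, E s /\ Rbar_le s (c + d + eta)).
  { intros eta heta; destruct (hev eta heta) as [T hT].
    eexists; split; [exists T; reflexivity|].
    apply (Lub_Rbar_correct (fun y : R => exists t : R, T <= t /\ y = f t)).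
    intros y [t [ht hy]]; subst y; apply hT, ht. }
  unfold LimSup_p_infty; fold E.
  assert (hglb : Rbar_is_glb E (Rbar_glb E)).
  { unfold Rbar_glb; destruct (Rbar_ex_glb E) as [l hl]; exact hl. }
  destruct hglb as [hlb hgr].
  assert (h1 : forall eta, 0 < eta -> Rbar_le (c - d - eta) (Rbar_glb E)).
  { intros eta heta; apply hgr; intros s hs; apply (hlow eta heta s hs). }
  assert (h2 : forall eta, 0 < eta -> Rbar_le (Rbar_glb E) (c + d + eta)).
  { intros eta heta; destruct (hup eta heta) as [s [hs hle]].
    apply (Rbar_le_trans _ s); [apply hlb, hs|exact hle]. }
  destruct (Rbar_glb E) as [h| |].
  - exists h; split; [reflexivity|]; apply Rabs_le_between; split.
    + apply Rnot_lt_le; intros hlt; pose proof (h1 ((- d - (h - c)) / 2) ltac:(lra)) as h3.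
      simpl in h3; lra.
    + apply Rnot_lt_le; intros hlt; pose proof (h2 ((h - c - d) / 2) ltac:(lra)) as h3.
      simpl in h3; lra.
  - destruct (h2 1 ltac:(lra)).
  - destruct (h1 1 ltac:(lra)).
Qed.

Lemma is_derive_shift (f : R -> R) (a t l : R) :
  is_derive f (a + t) l -> is_derive (fun s => f (a + s)) t l.
Proof.
  intros h; replace l with (scal 1 l) by (unfold scal; simpl; unfold mult; simpl; ring).
  apply (is_derive_comp f (fun s => a + s) t l 1); [exact h|].
  auto_derive; [exact I|ring].
Qed.

Lemma solves_componentwise_shift (sigma beta eps a : R) (g : R -> vec3) :
  solves_componentwise sigma beta eps g ->
  solves_componentwise sigma beta eps (fun t => g (a + t)).
Proof.
  intros [h1 [h2 h3]]; split; [|split]; intros t.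
  - apply (is_derive_shift (fun s => fst (fst (g s)))), h1.
  - apply (is_derive_shift (fun s => snd (fst (g s)))), h2.
  - apply (is_derive_shift (fun s => snd (g s))), h3.
Qed.

Lemma near_orbit_components (g0 : R -> vec3) (d : R) (p : vec3) :
  near_orbit g0 d p -> exists s,
    Rabs (fst (fst p) - fst (fst (g0 s))) <= d /\
    Rabs (snd (fst p) - snd (fst (g0 s))) <= d /\
    Rabs (snd p - snd (g0 s)) <= d.
Proof.
  intros [s hs]; exists s.
  destruct (norm_vec3_bounds (minus p (g0 s))) as [h1 [h2 h3]].
  change (Rabs (fst (fst p) - fst (fst (g0 s))) <= norm (minus p (g0 s))) in h1.
  change (Rabs (snd (fst p) - snd (fst (g0 s))) <= norm (minus p (g0 s))) in h2.
  change (Rabs (snd p - snd (g0 s)) <= norm (minus p (g0 s))) in h3.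
  repeat split; lra.
Qed.

(** At every time [a] the orbit is within C eps of some point of the unperturbed orbit. The
    comparison is restarted there with a new phase [s], so errors do not accumulate from one period
    to the next and the bound is uniform in [a]. *)
Lemma period_increment_near (sigma beta eps M C T m : R) (g g0 : R -> vec3) (J Z0 : R -> R) :
  0 <= eps <= 1 -> 0 <= C -> 0 < T ->
  solves_componentwise sigma beta eps g -> solves_componentwise sigma beta 0 g0 ->
  (forall t, Rabs (fst (fst (g0 t))) <= M /\ Rabs (snd (fst (g0 t))) <= M /\
             Rabs (snd (g0 t)) <= M) ->
  (forall t, is_derive Z0 t (snd (g0 t))) -> (forall t, Z0 (t + T) = Z0 t + T * m) ->
  (forall t, is_derive J t (snd (g t))) ->
  (forall t, near_orbit g0 (C * eps) (g t)) ->
  let N := sigma ^ 2 * (M + C) ^ 2 + (M + C) ^ 2 + beta ^ 2 * (M + C + Rabs sigma) ^ 2 in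
  let Q := (3 * C ^ 2 + N) * exp ((2 * (M + C) + 2) * T) + 1 in
  (forall t, Rabs (snd (g t)) <= M + C) /\
  forall a, Rabs (J (a + T) - J a - T * m) <= T * (eps * Q).
Proof.
  intros heps hC hT hg hg0 hb hZ hZT hJ hnear N Q.
  assert (hM : 0 <= M).
  { destruct (hb 0) as [h _]; pose proof (Rabs_pos (fst (fst (g0 0)))); lra. }
  assert (hCe : C * eps <= C) by nra.
  assert (hgb : forall t, Rabs (fst (fst (g t))) <= M + C /\
    Rabs (snd (fst (g t))) <= M + C /\ Rabs (snd (g t)) <= M + C).
  { intros t; destruct (near_orbit_components _ _ _ (hnear t)) as [s [h1 [h2 h3]]].
    destruct (hb s) as [b1 [b2 b3]].
    assert (tri : forall u v, Rabs (u - v) <= C * eps -> Rabs v <= M -> Rabs u <= M + C).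
    { intros u v hu hv; replace u with (v + (u - v)) by ring.
      pose proof (Rabs_triang v (u - v)); lra. }
    split; [|split]; eapply tri; eassumption. }
  split; [intros t; apply hgb|]; intros a.
  destruct (near_orbit_components _ _ _ (hnear a)) as [s [h1 [h2 h3]]].
  assert (hr : forall t, 0 <= t <= T -> Rabs (snd (g (a + t)) - snd (g0 (s + t))) <= eps * Q).
  { apply (perturbation_estimate sigma beta eps (M + C) C T
      (fun t => g (a + t)) (fun t => g0 (s + t))); try lra.
    - apply solves_componentwise_shift, hg.
    - apply solves_componentwise_shift, hg0.
    - intros t; apply hgb.
    - rewrite !Rplus_0_r; exact h1.
    - rewrite !Rplus_0_r; exact h2.
    - rewrite !Rplus_0_r; exact h3. }
  pose proof (mean_value_abs_le (fun t => J (a + t) - Z0 (s + t))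
    (fun t => snd (g (a + t)) - snd (g0 (s + t))) 0 T (eps * Q) ltac:(lra)) as hmv.
  cbv beta in hmv; rewrite !Rplus_0_r, hZT in hmv.
  replace (J (a + T) - J a - T * m) with
    (J (a + T) - (Z0 s + T * m) - (J a - Z0 s)) by ring.
  rewrite Rminus_0_r in hmv; apply hmv; [|exact hr].
  intros t _; apply (is_derive_minus (fun t => J (a + t)) (fun t => Z0 (s + t))).
  - apply is_derive_shift, hJ.
  - apply is_derive_shift, hZ.
Qed.

(** * From the average of zeta to the transport *)

Lemma lorenz_Z_derivative (sigma rho beta : R) (L : R -> vec3) :
  is_solution (lorenz sigma rho beta) L ->
  (forall t, is_derive (fun s => snd (L s)) t
     (- beta * snd (L t) + fst (fst (L t)) * snd (fst (L t)))) /\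
  (forall t, continuous (fun s => fst (fst (L s)) * snd (fst (L s))) t).
Proof.
  intros h; split; intros t; specialize (h t).
  - destruct (L t) as [[x y] z]; apply is_derive_snd in h; exact h.
  - apply is_derive_fst in h.
    apply (continuous_mult (fun s => fst (fst (L s))) (fun s => snd (fst (L s)))).
    + apply (ex_derive_continuous (fun s => fst (fst (L s)))).
      eexists; apply (is_derive_fst (fun s => fst (L s))), h.
    + apply (ex_derive_continuous (fun s => snd (fst (L s)))).
      eexists; apply (is_derive_snd (fun s => fst (L s))), h.
Qed.

Lemma snd_rescale (sigma rho : R) (L : R -> vec3) (tau : R) :
  snd (rescale sigma rho L tau)
  = sigma * (eps_of rho ^ 2 * snd (L (eps_of rho * tau)) - 1).
Proof. unfold rescale; destruct (L _) as [[x y] z]; reflexivity. Qed.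

Definition XY_integral (L : R -> vec3) (t : R) : R :=
  RInt (fun s => fst (fst (L s)) * snd (fst (L s))) 0 t.

(* Since XY = Z' + beta Z, this expresses the integral of zeta through that of XY. *)
Lemma is_derive_zeta_primitive (sigma rho beta : R) (L : R -> vec3) :
  0 < beta -> is_solution (lorenz sigma rho beta) L ->
  let eps := eps_of rho in
  let P := XY_integral L in
  forall tau, is_derive
    (fun tau => sigma * (eps / beta * (P (eps * tau) - snd (L (eps * tau))) - tau)) tau
    (snd (rescale sigma rho L tau)).
Proof.
  intros hbeta hL eps P tau.
  destruct (lorenz_Z_derivative _ _ _ _ hL) as [hZ hXY].
  pose proof (is_derive_primitive _ 0 (eps * tau) hXY) as hP.
  change (is_derive P (eps * tau) (fst (fst (L (eps * tau))) * snd (fst (L (eps * tau))))) in hP.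
  assert (hd : is_derive (fun t => P t - snd (L t)) (eps * tau) (beta * snd (L (eps * tau)))).
  { pose proof (is_derive_minus _ _ _ _ _ hP (hZ (eps * tau))) as h.
    match type of h with is_derive _ _ ?v =>
      replace (beta * snd (L (eps * tau))) with v; [exact h|] end.
    unfold minus, plus, opp; simpl; ring. }
  set (F := fun t => P t - snd (L t)) in hd.
  change (is_derive (fun tau => sigma * (eps / beta * F (eps * tau) - tau)) tau
    (snd (rescale sigma rho L tau))).
  rewrite snd_rescale; fold eps.
  auto_derive; [repeat split; eexists; exact hd|].
  rewrite_Derive hd; field; lra.
Qed.

(** Here m is the mean of zeta over the unperturbed orbit, encoded by the increment T m of its
    primitive [Z0]. As Z = eps^-2 (zeta / sigma + 1) and the transport is beta times the mean of Z,
    the leading term is beta rho (1 + m / sigma). Only zeta must have period T, not the whole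
    orbit. *)
Lemma transport_expansion_near_orbit (beta sigma T m M : R) (g0 : R -> vec3) (Z0 : R -> R)
    (L : R -> R -> vec3) (C rho1 rho2 : R) :
  0 < beta -> 0 < sigma -> 0 < T -> 0 <= C ->
  solves_componentwise sigma beta 0 g0 ->
  (forall t, Rabs (fst (fst (g0 t))) <= M /\ Rabs (snd (fst (g0 t))) <= M /\
             Rabs (snd (g0 t)) <= M) ->
  (forall t, is_derive Z0 t (snd (g0 t))) -> (forall t, Z0 (t + T) = Z0 t + T * m) ->
  (forall rho, rho1 < rho -> is_solution (lorenz sigma rho beta) (L rho)) ->
  (forall rho, rho2 < rho ->
     is_solution (rescaled_lorenz sigma beta (eps_of rho)) (rescale sigma rho (L rho)) /\
     forall t, near_orbit g0 (C * eps_of rho) (rescale sigma rho (L rho) t)) ->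
  transport_expansion beta (- m / sigma) (fun rho => transport (L rho)).
Proof.
  intros hbeta hsig hT hC hg0 hb hZ hZT hL hg.
  set (N := sigma ^ 2 * (M + C) ^ 2 + (M + C) ^ 2 + beta ^ 2 * (M + C + Rabs sigma) ^ 2).
  set (Q := (3 * C ^ 2 + N) * exp ((2 * (M + C) + 2) * T) + 1).
  (* An error eps Q in the mean of zeta is divided by sigma in the mean of Z / rho. Taking rho > 1
     ensures eps <= 1. *)
  exists (Q / sigma), (Rmax 1 (Rmax rho1 rho2)); split.
  { apply (Rlt_le_trans _ 1); [lra|apply Rmax_l]. }
  intros rho hrho.
  pose proof (Rmax_l 1 (Rmax rho1 rho2)); pose proof (Rmax_r 1 (Rmax rho1 rho2)).
  pose proof (Rmax_l rho1 rho2); pose proof (Rmax_r rho1 rho2).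
  specialize (hL rho ltac:(lra)); destruct (hg rho ltac:(lra)) as [hsol hnear]; clear hg.
  set (eps := eps_of rho) in *.
  assert (hsq : 1 < sqrt rho) by (rewrite <- sqrt_1; apply sqrt_lt_1; lra).
  assert (heps : 0 < eps <= 1).
  { unfold eps, eps_of; split; [apply Rinv_0_lt_compat; lra|].
    rewrite <- Rinv_1; apply Rinv_le_contravar; lra. }
  assert (heps2 : eps ^ 2 = / rho).
  { unfold eps, eps_of; rewrite pow_inv, pow2_sqrt by lra; reflexivity. }
  set (P := XY_integral (L rho)).
  pose (J := fun tau =>
    sigma * (eps / beta * (P (eps * tau) - snd (L rho (eps * tau))) - tau)).
  assert (hJ : forall tau, is_derive J tau (snd (rescale sigma rho (L rho) tau)))
    by (apply is_derive_zeta_primitive; assumption).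
  destruct (period_increment_near sigma beta eps M C T m
    (rescale sigma rho (L rho)) g0 J Z0 ltac:(lra) hC hT
    (is_solution_componentwise _ _ _ _ hsol) hg0 hb hZ hZT hJ hnear) as [hbd hinc].
  fold N Q in hinc.
  pose proof (average_of_periodic_increments J _ T m (M + C) (eps * Q) hT hJ hbd hinc) as hav.
  set (K0 := T * (M + C + Rabs m)) in hav.
  (* The boundary term Z(t) / t must vanish as t grows; Z is bounded because zeta is. *)
  assert (hZb : forall t, Rabs (snd (L rho t)) <= rho * ((M + C) / sigma + 1)).
  { intros t; pose proof (hbd (t / eps)) as h; rewrite snd_rescale in h; fold eps in h.
    replace (eps * (t / eps)) with t in h by (field; lra).
    rewrite heps2 in h.
    replace (snd (L rho t)) with
      (rho * (sigma * (/ rho * snd (L rho t) - 1) / sigma + 1)) by (field; lra).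
    rewrite Rabs_mult, (Rabs_pos_eq rho) by lra; apply Rmult_le_compat_l; [lra|].
    apply (Rle_trans _ _ _ (Rabs_triang _ _)); rewrite Rabs_R1.
    apply Rplus_le_compat_r; unfold Rdiv; rewrite Rabs_mult.
    rewrite (Rabs_pos_eq (/ sigma)) by (left; apply Rinv_0_lt_compat; lra).
    apply Rmult_le_compat_r; [left; apply Rinv_0_lt_compat; lra|exact h]. }
  set (BZ := rho * ((M + C) / sigma + 1)) in hZb.
  pose (bs := beta / (sigma * eps)).
  assert (hbs : 0 < bs).
  { unfold bs; apply Rdiv_lt_0_compat; [lra|apply Rmult_lt_0_compat; lra]. }
  pose (c := beta / eps ^ 2 * (1 + m / sigma)).
  destruct (LimSup_p_infty_near (fun t => / t * P t) c
    (beta / eps ^ 2 * (eps * Q / sigma)) (BZ + bs * (K0 + Rabs (J 0)))) as [h [hh hhc]].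
  { intros t ht; set (tau := t / eps).
    assert (htau : 0 < tau) by (unfold tau; apply Rdiv_lt_0_compat; lra).
    specialize (hav tau ltac:(lra)).
    (* The definition of [J] solved for the integral of XY; [bs] is the scale factor between the
       two. *)
    assert (hPt : P t = snd (L rho t) + bs * (J tau + sigma * tau)).
    { unfold J, bs, tau; replace (eps * (t / eps)) with t by (field; lra).
      field; lra. }
    assert (hdec : / t * P t - c = / t * (snd (L rho t)
      + bs * (J 0 + (J tau - J 0 - tau * m)))).
    { rewrite hPt; unfold c, bs, tau; field; lra. }
    rewrite hdec, Rabs_mult, (Rabs_pos_eq (/ t)) by (left; apply Rinv_0_lt_compat; lra).
    replace (beta / eps ^ 2 * (eps * Q / sigma) + (BZ + bs * (K0 + Rabs (J 0))) / t)
      with (/ t * (BZ + bs * (Rabs (J 0) + (tau * (eps * Q) + K0))))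
      by (unfold tau, bs; field; lra).
    apply Rmult_le_compat_l; [left; apply Rinv_0_lt_compat; lra|].
    apply (Rle_trans _ _ _ (Rabs_triang _ _)).
    apply Rplus_le_compat; [apply hZb|].
    rewrite Rabs_mult, (Rabs_pos_eq bs) by lra; apply Rmult_le_compat_l; [lra|].
    apply (Rle_trans _ _ _ (Rabs_triang _ _)); lra. }
  exists (h / (rho * beta) - (1 + m / sigma)).
  assert (hc : c = rho * beta * (1 + m / sigma)).
  { unfold c; rewrite heps2; field; lra. }
  split.
  - replace (Rpower rho (- (1 / 2))) with eps.
    2:{ unfold eps, eps_of; rewrite Rpower_Ropp; f_equal.
        replace (1 / 2) with (/ 2) by field; symmetry; apply Rpower_sqrt; lra. }
    replace (h / (rho * beta) - (1 + m / sigma)) with ((h - c) / (rho * beta))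
      by (rewrite hc; field; lra).
    assert (hrb : 0 < rho * beta) by nra.
    unfold Rdiv at 1; rewrite Rabs_mult.
    rewrite (Rabs_pos_eq (/ _)) by (left; apply Rinv_0_lt_compat; lra).
    apply (Rmult_le_reg_r (rho * beta)); [exact hrb|].
    rewrite Rmult_assoc, Rinv_l, Rmult_1_r by lra.
    apply (Rle_trans _ _ _ hhc); right; rewrite heps2; field; lra.
  - change (transport (L rho)) with (LimSup_p_infty (fun t => / t * P t)).
    rewrite hh; simpl; f_equal; field; lra.
Qed.

(** * The amplitude function: inverse, period and derivative *)

(** For the primitive F, both F(x + pi) - F(x) and F(x) + F(pi - x) have zero derivative; evaluating
    them at 0 and pi/2 relates a shift by pi to twice the quarter integral. *)
Lemma RInt_period_PI (f : R -> R) (phi : R) :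
  (forall x, continuous f x) -> (forall x, f (x + PI) = f x) ->
  (forall x, f (PI - x) = f x) ->
  RInt f 0 (phi + PI) = RInt f 0 phi + 2 * RInt f 0 (PI / 2).
Proof.
  intros hf hper hsym.
  pose (F := (fun x => RInt f 0 x) : R -> R).
  assert (hF : forall x, is_derive F x (f x)) by (intros x; apply is_derive_primitive, hf).
  assert (hF0 : F 0 = 0) by exact (RInt_point 0 f).
  assert (const : forall G : R -> R, (forall x, is_derive G x 0) -> forall x y, G x = G y).
  { intros G hG x y; destruct (MVT_gen G x y (fun _ => 0)) as [c [_ hc]].
    - intros; apply hG.
    - intros z _; apply continuity_pt_filterlim, (ex_derive_continuous G).
      eexists; apply hG.
    - lra. }
  assert (h1 := const (fun x => F (x + PI) - F x)); cbv beta in h1.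
  assert (h2 := const (fun x => F x + F (PI - x))); cbv beta in h2.
  change (F (phi + PI) = F phi + 2 * F (PI / 2)).
  lapply h1; [clear h1; intros h1|].
  - lapply h2; [clear h2; intros h2|].
    + specialize (h1 phi 0); specialize (h2 0 (PI / 2)).
      rewrite Rplus_0_l in h1; rewrite Rminus_0_r in h2.
      replace (PI - PI / 2) with (PI / 2) in h2 by field; lra.
    + intros x; auto_derive; [repeat split; eexists; apply hF|].
      rewrite_Derive (hF x); rewrite_Derive (hF (PI + - x)).
      replace (PI + - x) with (PI - x) by ring; rewrite hsym; ring.
  - intros x; auto_derive; [repeat split; eexists; apply hF|].
    rewrite_Derive (hF (x + PI)); rewrite_Derive (hF x); rewrite hper; ring.
Qed.

Lemma Delta_shift_PI (k x : R) : ellDelta k (x + PI) = ellDelta k x.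
Proof. unfold ellDelta; rewrite neg_sin; do 2 f_equal; ring. Qed.

Lemma Delta_reflect_PI (k x : R) : ellDelta k (PI - x) = ellDelta k x.
Proof. unfold ellDelta; rewrite sin_PI_x; reflexivity. Qed.

Lemma is_derive_ellF (k phi : R) (hk : 0 < k < 1) :
  is_derive (fun x => ellF x k) phi (/ ellDelta k phi).
Proof.
  apply (is_derive_primitive (fun t => / ellDelta k t)).
  intros; apply continuous_inv_Delta, hk.
Qed.

Lemma ellF_shift_PI (k phi : R) (hk : 0 < k < 1) :
  ellF (phi + PI) k = ellF phi k + 2 * ellK k.
Proof.
  rewrite ellK_RInt by exact hk.
  apply (RInt_period_PI (fun t => / ellDelta k t)).
  - intros; apply continuous_inv_Delta, hk.
  - intros; rewrite Delta_shift_PI; reflexivity.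
  - intros; rewrite Delta_reflect_PI; reflexivity.
Qed.

Definition incomplete_ellE (phi k : R) : R := RInt (ellDelta k) 0 phi.

Lemma is_derive_incomplete_ellE (k phi : R) (hk : 0 < k < 1) :
  is_derive (fun x => incomplete_ellE x k) phi (ellDelta k phi).
Proof. apply (is_derive_primitive (ellDelta k)); intros; apply continuous_Delta, hk. Qed.

Lemma incomplete_ellE_shift_PI (k phi : R) (hk : 0 < k < 1) :
  incomplete_ellE (phi + PI) k = incomplete_ellE phi k + 2 * ellE k.
Proof.
  rewrite ellE_RInt by exact hk.
  apply (RInt_period_PI (ellDelta k)).
  - intros; apply continuous_Delta, hk.
  - intros; apply Delta_shift_PI.
  - intros; apply Delta_reflect_PI.
Qed.

(** The derivative 1 / Delta is at least 1. This one bound yields injectivity of [ellF], its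
    surjectivity, and the Lipschitz continuity of its inverse [am]. *)
Lemma ellF_expansive (k a b : R) (hk : 0 < k < 1) :
  a <= b -> b - a <= ellF b k - ellF a k.
Proof.
  intros hab.
  assert (h : b - ellF b k <= a - ellF a k); [|lra].
  apply (mean_value_le (fun t => t - ellF t k) (fun t => 1 - / ellDelta k t)); [exact hab| |].
  - intros t _; apply (is_derive_minus (fun t => t) (fun t => ellF t k)).
    + apply (is_derive_id (K := R_AbsRing)).
    + apply is_derive_ellF, hk.
  - intros t _; pose proof (inv_Delta_ge_1 k t hk); lra.
Qed.

Lemma ellF_expansive_abs (k a b : R) (hk : 0 < k < 1) :
  Rabs (b - a) <= Rabs (ellF b k - ellF a k).
Proof.
  destruct (Rle_or_lt a b) as [h|h].
  - pose proof (ellF_expansive k a b hk h); rewrite !Rabs_pos_eq; lra.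
  - pose proof (ellF_expansive k b a hk ltac:(lra)).
    rewrite (Rabs_minus_sym b), (Rabs_minus_sym (ellF b k)), !Rabs_pos_eq; lra.
Qed.

Lemma ellF_inj (k a b : R) (hk : 0 < k < 1) : ellF a k = ellF b k -> a = b.
Proof.
  intros h; pose proof (ellF_expansive_abs k a b hk) as h1.
  rewrite h, Rminus_diag, Rabs_R0 in h1.
  pose proof (Rabs_pos (b - a)).
  destruct (Req_dec (b - a) 0) as [h0|h0]; [lra|].
  apply Rabs_pos_lt in h0; lra.
Qed.

(** [am] is given by [iota], so existence and uniqueness of the inverse value are what gives it
    meaning. By expansiveness [u] lies between the values at [- Rabs u] and [Rabs u]. *)
Lemma ellF_am (k u : R) (hk : 0 < k < 1) : ellF (am u k) k = u.
Proof.
  apply (iota_correct (fun phi : R => ellF phi k = u)).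
  assert (h0 : ellF 0 k = 0) by exact (RInt_point 0 _).
  pose proof (Rabs_pos u) as hu; pose proof (Rle_abs u); pose proof (Rle_abs (- u)) as hu'.
  rewrite Rabs_Ropp in hu'.
  pose proof (ellF_expansive k 0 (Rabs u) hk hu).
  pose proof (ellF_expansive k (- Rabs u) 0 hk ltac:(lra)).
  destruct (IVT_gen (fun x => ellF x k) (- Rabs u) (Rabs u) u) as [x [_ hx]].
  - intros x; apply continuity_pt_filterlim, (ex_derive_continuous (fun x => ellF x k)).
    eexists; apply is_derive_ellF, hk.
  - rewrite Rmin_left, Rmax_right; lra.
  - exists x; split; [exact hx|]; intros y hy; apply (ellF_inj k x y hk); lra.
Qed.

Lemma am_shift_period (k u : R) (hk : 0 < k < 1) : am (u + 2 * ellK k) k = am u k + PI.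
Proof.
  apply (ellF_inj k _ _ hk); rewrite ellF_shift_PI, !ellF_am by exact hk; reflexivity.
Qed.

(** By the mean value theorem for [ellF], each difference quotient of [am] equals Delta at a point
    between [am u k] and [am (u + h) k]; that point is within |h| of [am u k], and Delta is
    continuous. *)
Lemma is_derive_am (k u : R) (hk : 0 < k < 1) :
  is_derive (fun u => am u k) u (ellDelta k (am u k)).
Proof.
  apply is_derive_Reals; intros eps heps.
  pose proof (continuous_Delta k (am u k) hk) as hc.
  assert (hball := proj1 (filterlim_locally _ _) hc (mkposreal eps heps)).
  destruct hball as [d hd]; exists d; intros h hh0 hhd.
  destruct (MVT_gen (fun x => ellF x k) (am u k) (am (u + h) k) (fun x => / ellDelta k x))
    as [c [hcr hce]].
  { intros x _; apply is_derive_ellF, hk. }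
  { intros x _; apply continuity_pt_filterlim, (ex_derive_continuous (fun x => ellF x k)).
    eexists; apply is_derive_ellF, hk. }
  rewrite !ellF_am in hce by exact hk.
  pose proof (Delta_pos k c hk) as hp.
  assert (hq : (am (u + h) k - am u k) / h = ellDelta k c).
  { replace (am (u + h) k - am u k) with (ellDelta k c * h).
    - field; exact hh0.
    - replace h with (u + h - u) at 1 by ring; rewrite hce; field; lra. }
  rewrite hq; apply (hd c).
  unfold ball; simpl; unfold AbsRing_ball, abs, minus, plus, opp; simpl.
  fold (Rminus c (am u k)).
  apply (Rle_lt_trans _ (Rabs (am (u + h) k - am u k))).
  - revert hcr; unfold Rmin, Rmax; destruct (Rle_dec (am u k) (am (u + h) k)); intros hcr.
    + rewrite !Rabs_pos_eq; lra.
    + rewrite !Rabs_left1; lra.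
  - apply (Rle_lt_trans _ _ _ (ellF_expansive_abs k _ _ hk)).
    rewrite !ellF_am by exact hk; replace (u + h - u) with h by ring; exact hhd.
Qed.

Lemma is_derive_am_linear (k w t : R) (hk : 0 < k < 1) :
  is_derive (fun t => am (w * t) k) t (w * ellDelta k (am (w * t) k)).
Proof.
  apply (is_derive_comp (fun u => am u k) (fun t => w * t) t _ w).
  - apply is_derive_am, hk.
  - auto_derive; [exact I|ring].
Qed.

Lemma is_derive_Delta_am_linear (k w t : R) (hk : 0 < k < 1) :
  let a := am (w * t) k in
  is_derive (fun t => ellDelta k (am (w * t) k)) t (- w * k ^ 2 * sin a * cos a).
Proof.
  intros a.
  pose proof (is_derive_comp (ellDelta k) (fun t => am (w * t) k) t _ _
    (is_derive_Delta k _ hk) (is_derive_am_linear k w t hk)) as h.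
  fold a in h; pose proof (Delta_pos k a hk).
  match type of h with is_derive _ _ ?v =>
    replace (- w * k ^ 2 * sin a * cos a) with v; [exact h|] end.
  unfold scal; simpl; unfold mult; simpl; field; lra.
Qed.

(** * The unperturbed orbits: equations, bounds and primitives of zeta *)

(** Differentiates an expression in opaque functions [a] (the amplitude along the orbit) and [D]
    (its delta) by the rules [ha] and [hD], leaving an algebraic identity. *)
Ltac derive_along a ha D hD :=
  auto_derive;
  [ repeat split;
    match goal with
    | |- ex_derive ?f ?x => match f with
      | context [a] => eexists; exact (ha x)
      | context [D] => eexists; exact (hD x)
      end
    end
  | repeat match goal with
    | |- context [Derive ?f ?x] => match f with
      | context [a] => rewrite (is_derive_unique f x _ (ha x))
      | context [D] => rewrite (is_derive_unique f x _ (hD x))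
      end
    end ].

Lemma cn_orbit_solves (sigma beta k B : R) (hk : 0 < k < 1) (hB : 0 < B) :
  solves_componentwise sigma beta 0 (cn_orbit k B).
Proof.
  assert (hw : sqrt B ^ 2 = B) by (apply pow2_sqrt; lra).
  pose (a := fun t => am (sqrt B * t) k); pose (D := fun t => ellDelta k (a t)).
  assert (ha : forall t, is_derive a t (sqrt B * D t)).
  { intros t; exact (is_derive_am_linear k _ t hk). }
  assert (hD : forall t, is_derive D t (- sqrt B * k ^ 2 * sin (a t) * cos (a t))).
  { intros t; exact (is_derive_Delta_am_linear k _ t hk). }
  assert (hs : forall t, D t ^ 2 = 1 - k ^ 2 * sin (a t) ^ 2).
  { intros t; apply Delta_sqr, hk. }
  change (solves_componentwise sigma beta 0 (fun t =>
    (2 * k * sqrt B * cos (a t), - 2 * k * B * D t * sin (a t),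
     B * (1 - 2 * k ^ 2 * sin (a t) ^ 2)))).
  clearbody D; clearbody a; set (w := sqrt B) in *; clearbody w.
  split; [|split]; intros t; cbn [fst snd]; rewrite <- hw; specialize (hs t).
  - derive_along a ha D hD; ring.
  (* The two sides differ by a multiple of the relation between [D t ^ 2] and [sin (a t) ^ 2]. *)
  - derive_along a ha D hD; apply Rminus_diag_uniq.
    transitivity (- 2 * k * w ^ 3 * cos (a t) * (D t ^ 2 - (1 - k ^ 2 * sin (a t) ^ 2)));
      [ring|rewrite hs; ring].
  - derive_along a ha D hD; ring.
Qed.

Lemma dn_orbit_solves (sigma beta s k B : R) (hk : 0 < k < 1) (hB : 0 < B)
    (hs1 : s = 1 \/ s = -1) :
  solves_componentwise sigma beta 0 (dn_orbit s k B).
Proof.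
  assert (hw : (sqrt B * / k) ^ 2 * k ^ 2 = B).
  { replace ((sqrt B * / k) ^ 2 * k ^ 2) with (sqrt B ^ 2) by (field; lra).
    apply pow2_sqrt; lra. }
  assert (hss : s ^ 2 = 1) by (destruct hs1; subst s; ring).
  pose (w := sqrt B * / k).
  pose (a := fun t => am (w * t) k); pose (D := fun t => ellDelta k (a t)).
  assert (ha : forall t, is_derive a t (w * D t)).
  { intros t; exact (is_derive_am_linear k _ t hk). }
  assert (hD : forall t, is_derive D t (- w * k ^ 2 * sin (a t) * cos (a t))).
  { intros t; exact (is_derive_Delta_am_linear k _ t hk). }
  assert (hsw : sqrt B = w * k) by (unfold w; field; lra).
  change (solves_componentwise sigma beta 0 (fun t =>
    (s * (2 * sqrt B * / k * D t), - s * (2 * B * sin (a t) * cos (a t)),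
     B * (1 - 2 * sin (a t) ^ 2)))).
  rewrite hsw; fold w in hw; clearbody D; clearbody a; clearbody w.
  split; [|split]; intros t; cbn [fst snd]; rewrite <- hw.
  - derive_along a ha D hD; field; lra.
  - assert (hc : cos (a t) ^ 2 = 1 - sin (a t) ^ 2) by (rewrite sin_sqr_cos_sqr; ring).
    derive_along a ha D hD; field [hc]; lra.
  - derive_along a ha D hD; field [hss]; lra.
Qed.

Lemma Rabs_mult_le (u v p q : R) : Rabs u <= p -> Rabs v <= q -> Rabs (u * v) <= p * q.
Proof.
  intros hu hv; rewrite Rabs_mult.
  apply Rmult_le_compat; try apply Rabs_pos; assumption.
Qed.

Lemma Rabs_sin_le (x : R) : Rabs (sin x) <= 1.
Proof. apply Rabs_le_between; pose proof (SIN_bound x); lra. Qed.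

Lemma Rabs_cos_le (x : R) : Rabs (cos x) <= 1.
Proof. apply Rabs_le_between; pose proof (COS_bound x); lra. Qed.

Lemma Rabs_Delta_le (k x : R) (hk : 0 < k < 1) : Rabs (ellDelta k x) <= 1.
Proof.
  rewrite Rabs_pos_eq; [apply Delta_le_1|left; apply Delta_pos, hk].
Qed.

Lemma Rabs_one_minus_two_sin_sqr_le (c x : R) :
  0 <= c <= 1 -> Rabs (1 - 2 * c * sin x ^ 2) <= 1.
Proof.
  intros hc; apply Rabs_le_between.
  pose proof (sin_sqr_cos_sqr x); pose proof (pow2_ge_0 (sin x)); pose proof (pow2_ge_0 (cos x)).
  split; nra.
Qed.

Lemma cn_orbit_bounded (k B : R) (hk : 0 < k < 1) (hB : 0 < B) (t : R) :
  let M := 2 * sqrt B + 2 * B in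
  Rabs (fst (fst (cn_orbit k B t))) <= M /\ Rabs (snd (fst (cn_orbit k B t))) <= M /\
  Rabs (snd (cn_orbit k B t)) <= M.
Proof.
  intros M; pose proof (sqrt_lt_R0 B hB) as hw; cbn [cn_orbit fst snd].
  split; [|split].
  - apply (Rle_trans _ (2 * k * sqrt B * 1)).
    + apply Rabs_mult_le; [|apply Rabs_cos_le].
      rewrite Rabs_pos_eq; [lra|]; repeat apply Rmult_le_pos; lra.
    + unfold M; nra.
  - apply (Rle_trans _ (2 * k * B * 1 * 1)).
    + apply Rabs_mult_le; [apply Rabs_mult_le|apply Rabs_sin_le].
      * replace (- 2 * k * B) with (- (2 * k * B)) by ring.
        rewrite Rabs_Ropp, Rabs_pos_eq; [lra|]; repeat apply Rmult_le_pos; lra.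
      * apply Rabs_Delta_le, hk.
    + unfold M; nra.
  - apply (Rle_trans _ (B * 1)); [|unfold M; lra].
    apply Rabs_mult_le; [rewrite Rabs_pos_eq; lra|].
    apply Rabs_one_minus_two_sin_sqr_le; nra.
Qed.

Lemma dn_orbit_bounded (s k B : R) (hk : 0 < k < 1) (hB : 0 < B)
    (hs1 : s = 1 \/ s = -1) (t : R) :
  let M := 2 * sqrt B * / k + 2 * B in
  Rabs (fst (fst (dn_orbit s k B t))) <= M /\ Rabs (snd (fst (dn_orbit s k B t))) <= M /\
  Rabs (snd (dn_orbit s k B t)) <= M.
Proof.
  intros M; pose proof (sqrt_lt_R0 B hB) as hw; cbn [dn_orbit fst snd].
  assert (hi : 0 < / k) by (apply Rinv_0_lt_compat; lra).
  assert (hM : 0 < sqrt B * / k) by (apply Rmult_lt_0_compat; lra).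
  assert (hs : Rabs s <= 1).
  { apply Rabs_le_between; destruct hs1; lra. }
  split; [|split].
  - apply (Rle_trans _ (1 * (2 * sqrt B * / k * 1))); [|unfold M; lra].
    apply Rabs_mult_le; [exact hs|].
    apply Rabs_mult_le; [rewrite Rabs_pos_eq; lra|apply Rabs_Delta_le, hk].
  - apply (Rle_trans _ (1 * (2 * B * 1 * 1))); [|unfold M; lra].
    apply Rabs_mult_le; [rewrite Rabs_Ropp; exact hs|].
    apply Rabs_mult_le; [apply Rabs_mult_le|apply Rabs_cos_le].
    + rewrite Rabs_pos_eq; lra.
    + apply Rabs_sin_le.
  - apply (Rle_trans _ (B * 1)); [|unfold M; lra].
    apply Rabs_mult_le; [rewrite Rabs_pos_eq; lra|].
    pose proof (Rabs_one_minus_two_sin_sqr_le 1 (am (sqrt B * / k * t) k) ltac:(lra)) as h.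
    rewrite Rmult_1_r in h; exact h.
Qed.

(** Up to the time scale this is Jacobi's epsilon function, the primitive of dn^2. On both orbits
    zeta is affine in dn^2, so it gets an explicit primitive. *)
Lemma is_derive_incomplete_ellE_am (k w t : R) (hk : 0 < k < 1) :
  is_derive (fun t => incomplete_ellE (am (w * t) k) k) t
    (w * (1 - k ^ 2 * sin (am (w * t) k) ^ 2)).
Proof.
  pose proof (is_derive_comp (fun x => incomplete_ellE x k) (fun t => am (w * t) k) t _ _
    (is_derive_incomplete_ellE k _ hk) (is_derive_am_linear k w t hk)) as h.
  rewrite <- Delta_sqr by exact hk.
  match type of h with is_derive _ _ ?v =>
    replace (w * ellDelta k (am (w * t) k) ^ 2) with v; [exact h|] end.
  unfold scal; simpl; unfold mult; simpl; ring.
Qed.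

Lemma incomplete_ellE_am_shift (k w t : R) (hk : 0 < k < 1) (hw : 0 < w) :
  incomplete_ellE (am (w * (t + 2 * ellK k / w)) k) k
  = incomplete_ellE (am (w * t) k) k + 2 * ellE k.
Proof.
  replace (w * (t + 2 * ellK k / w)) with (w * t + 2 * ellK k) by (field; lra).
  rewrite am_shift_period, incomplete_ellE_shift_PI by exact hk; reflexivity.
Qed.

Lemma ellK_pos (k : R) (hk : 0 < k < 1) : 0 < ellK k.
Proof. pose proof (ellK_ge k hk); pose proof PI_RGT_0; lra. Qed.

(** * Transport along the symmetric and the asymmetric orbits *)

Lemma symmetric_orbit_transport (beta sigma k B : R) (L : R -> R -> vec3) :
  0 < beta -> 0 < sigma -> 0 < k < 1 -> 0 < B ->
  (exists rho0 : R, forall rho : R, rho0 < rho ->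
     is_solution (lorenz sigma rho beta) (L rho)) ->
  is_stable_symmetric_orbit beta sigma k B (fun rho => rescale sigma rho (L rho)) ->
  transport_expansion beta (ratio1 sigma k B) (fun rho => transport (L rho)).
Proof.
  intros hbeta hsig hk hB [rho1 hL] [C [rho2 [hC [_ hg]]]].
  pose proof (ellK_pos k hk) as hK.
  pose proof (sqrt_lt_R0 B hB) as hw.
  assert (hw2 : sqrt B ^ 2 = B) by (apply pow2_sqrt; lra).
  set (m := B * (2 * ellE k / ellK k - 1)).
  replace (ratio1 sigma k B) with (- m / sigma) by (unfold ratio1, m; field; lra).
  set (w := sqrt B) in *.
  (* The time 2K / w is the period of zeta, half that of the cn orbit. Since zeta = B (2 dn^2 - 1)
     and B / w = w, its primitive is 2 w times the epsilon function minus B t. *)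
  apply (transport_expansion_near_orbit beta sigma (2 * ellK k / w) m (2 * w + 2 * B)
    (cn_orbit k B) (fun t => 2 * w * incomplete_ellE (am (w * t) k) k - B * t)
    L C rho1 rho2); try lra.
  - apply Rdiv_lt_0_compat; lra.
  - apply cn_orbit_solves; assumption.
  - apply cn_orbit_bounded; assumption.
  - intros t.
    change (snd (cn_orbit k B t)) with (B * (1 - 2 * k ^ 2 * sin (am (w * t) k) ^ 2)).
    pose proof (is_derive_incomplete_ellE_am k w t hk) as h.
    set (F := fun t => incomplete_ellE (am (w * t) k) k) in h.
    change (is_derive (fun t => 2 * w * F t - B * t) t
      (B * (1 - 2 * k ^ 2 * sin (am (w * t) k) ^ 2))).
    auto_derive; [repeat split; eexists; exact h|].
    rewrite_Derive h; rewrite <- hw2; ring.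
  - intros t; rewrite incomplete_ellE_am_shift by assumption.
    unfold m; rewrite <- hw2; field; lra.
  - exact hL.
  - intros rho hrho; destruct (hg rho hrho) as [[[hsol _] [hnear _]] _].
    split; assumption.
Qed.

Lemma asymmetric_orbit_transport (beta sigma s k B : R) (L : R -> R -> vec3) :
  0 < beta -> 0 < sigma -> s = 1 \/ s = -1 -> 0 < k < 1 -> 0 < B ->
  (exists rho0 : R, forall rho : R, rho0 < rho ->
     is_solution (lorenz sigma rho beta) (L rho)) ->
  is_unstable_asymmetric_orbit beta sigma s k B (fun rho => rescale sigma rho (L rho)) ->
  transport_expansion beta (ratio2 sigma k B) (fun rho => transport (L rho)).
Proof.
  intros hbeta hsig hs hk hB [rho1 hL] [C [rho2 [hC [_ hg]]]].
  pose proof (ellK_pos k hk) as hK.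
  pose proof (sqrt_lt_R0 B hB) as hsB.
  set (m := B - 2 * B / k ^ 2 * (1 - ellE k / ellK k)).
  replace (ratio2 sigma k B) with (- m / sigma) by (unfold ratio2, m; field; lra).
  set (w := sqrt B * / k).
  assert (hw : 0 < w).
  { unfold w; apply Rmult_lt_0_compat; [exact hsB|apply Rinv_0_lt_compat; lra]. }
  (* With sn^2 = (1 - dn^2) / k^2, zeta becomes B - (2 B / k^2) (1 - dn^2), which integrates to the
     given [Z0]; its increment over 2K / w, divided by that time, is [m]. *)
  apply (transport_expansion_near_orbit beta sigma (2 * ellK k / w) m
    (2 * sqrt B * / k + 2 * B) (dn_orbit s k B)
    (fun t => B * t - 2 * B / k ^ 2 * (t - incomplete_ellE (am (w * t) k) k / w))
    L C rho1 rho2); try lra.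
  - apply Rdiv_lt_0_compat; lra.
  - apply dn_orbit_solves; assumption.
  - intros t; apply dn_orbit_bounded; assumption.
  - intros t.
    change (snd (dn_orbit s k B t)) with (B * (1 - 2 * sin (am (w * t) k) ^ 2)).
    pose proof (is_derive_incomplete_ellE_am k w t hk) as h.
    set (F := fun t => incomplete_ellE (am (w * t) k) k) in h.
    change (is_derive (fun t => B * t - 2 * B / k ^ 2 * (t - F t / w)) t
      (B * (1 - 2 * sin (am (w * t) k) ^ 2))).
    auto_derive; [repeat split; eexists; exact h|].
    rewrite_Derive h; field; lra.
  - intros t; rewrite incomplete_ellE_am_shift by assumption.
    unfold m; field; lra.
  - exact hL.
  - intros rho hrho; destruct (hg rho hrho) as [[[hsol _] [hnear _]] _].
    split; assumption.
Qed.

Theorem mainTheorem4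
  (beta : R) (hbeta : 0 < beta)
  (k1 B1 k2 B2 : R -> R)
  (h1 : forall lambda : R, 2 / 3 < lambda ->
     unique (S1 beta (sigma_of beta lambda)) (k1 lambda, B1 lambda))
  (h2 : forall lambda : R, 2 / 3 < lambda < 1 ->
     unique (S2 beta (sigma_of beta lambda)) (k2 lambda, B2 lambda)) :
  (forall lambda : R, 2 / 3 < lambda ->
     let sigma := sigma_of beta lambda in
     forall L : R -> R -> vec3,
     (exists rho0 : R, forall rho : R, rho0 < rho ->
        is_solution (lorenz sigma rho beta) (L rho)) ->
     is_stable_symmetric_orbit beta sigma (k1 lambda) (B1 lambda)
       (fun rho => rescale sigma rho (L rho)) ->
     transport_expansion beta (ratio1 sigma (k1 lambda) (B1 lambda))
       (fun rho => transport (L rho)))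
  /\
  (forall lambda : R, 2 / 3 < lambda < 1 ->
     let sigma := sigma_of beta lambda in
     forall s : R, s = 1 \/ s = -1 ->
     forall L : R -> R -> vec3,
     (exists rho0 : R, forall rho : R, rho0 < rho ->
        is_solution (lorenz sigma rho beta) (L rho)) ->
     is_unstable_asymmetric_orbit beta sigma s (k2 lambda) (B2 lambda)
       (fun rho => rescale sigma rho (L rho)) ->
     transport_expansion beta (ratio2 sigma (k2 lambda) (B2 lambda))
       (fun rho => transport (L rho)))
  /\
  (let r1 := fun lambda =>
     ratio1 (sigma_of beta lambda) (k1 lambda) (B1 lambda) in
   let r2 := fun lambda =>
     ratio2 (sigma_of beta lambda) (k2 lambda) (B2 lambda) in
   filterlim r1 (at_right (2 / 3)) (locally 1) /\
   filterlim r2 (at_right (2 / 3)) (locally 1) /\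
   filterlim r1 (Rbar_locally p_infty) (locally 0) /\
   filterlim r2 (at_left 1) (locally 0)).
Proof.
  assert (s1 : forall lambda, 2 / 3 < lambda ->
    S1 beta (sigma_of beta lambda) (k1 lambda, B1 lambda)) by (intros; apply h1; assumption).
  assert (s2 : forall lambda, 2 / 3 < lambda < 1 ->
    S2 beta (sigma_of beta lambda) (k2 lambda, B2 lambda)) by (intros; apply h2; assumption).
  assert (hsig : forall lambda, 2 / 3 < lambda -> 0 < sigma_of beta lambda).
  { intros lambda hl; unfold sigma_of; nra. }
  split; [|split].
  - intros lambda hl sigma L hL hg.
    destruct (s1 lambda hl) as [hk [hB _]].
    apply symmetric_orbit_transport; auto; apply hsig, hl.
  - intros lambda hl sigma s hs L hL hg.
    destruct (s2 lambda hl) as [hk [hB _]].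
    apply (asymmetric_orbit_transport beta sigma s); auto; apply hsig, hl.
  - destruct (ratio1_limits beta k1 B1 hbeta s1) as [l1 l2].
    destruct (ratio2_limits beta k2 B2 hbeta s2) as [l3 l4].
    intros r1 r2; repeat split; assumption.
Qed.
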